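(* Let $\Pi'=\Pi_1'\sqcup\Pi_2'$ be the simple roots of $\Delta'$, $\gamma=\tau_2\tau_1$ the Coxeter element and $d_1,\dots,d_{2s}$ the singular directions, chosen as described in the context (so that $\gamma=\mathrm{Ad}\,P_0|_{\mathfrak h'}$ and $\Delta'_+=\mathcal R(d_1)\sqcup\cdots\sqcup\mathcal R(d_s)$). Then for every $i$ the roots in $\mathcal R(d_i)$ are mutually orthogonal, and $$\mathcal R(d_1)=\Pi_2',\ \ \mathcal R(d_3)=\gamma(\Pi_2'),\ \dots,\ \mathcal R(d_{2s-1})=\gamma^{s-1}(\Pi_2'),$$ $$\mathcal R(d_2)=\gamma(-\Pi_1'),\ \ \mathcal R(d_4)=\gamma^2(-\Pi_1'),\ \dots,\ \mathcal R(d_{2s})=\gamma^s(-\Pi_1')=-\Pi_1'.$$ That is, $\mathcal R(d_{2k+1})=\gamma^k(\Pi'_2)$ for $0\le k\le s-1$ and $\mathcal R(d_{2k})=\gamma^k(-\Pi_1')$ for $1\le k\le s$.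
   Context: Let $G$ be a complex simple Lie group of rank $l>1$ with Lie algebra $\mathfrak g$, Cartan subalgebra $\mathfrak h$, simple roots $\alpha_1,\dots,\alpha_l$, highest root $\psi=\sum_{i=1}^l q_i\alpha_i$, $\alpha_0=-\psi$, Coxeter number $s=1+\sum_{i=1}^l q_i$, and nonzero root vectors $e_\alpha\in\mathfrak g_\alpha$. Let $\epsilon_1,\dots,\epsilon_l\in\mathfrak h$ satisfy $\alpha_i(\epsilon_j)=\delta_{ij}$, $x_0=\sum_{i=1}^l\epsilon_i$, and $P_0=\exp(2\pi\sqrt{-1}\,x_0/s)\in G$. Let $E_+=\sum_{i=0}^l c_i^+e_{\alpha_i}$ with all $c_i^+\in\mathbb C^*$; it is regular semisimple (Kostant). Let $\mathfrak h'$ be the Cartan subalgebra of $\mathfrak g$ centralizing $E_+$, $\Delta'$ the roots with respect to $\mathfrak h'$, $W'$ their Weyl group. $\mathrm{Ad}\,P_0$ preserves $\mathfrak h'$ and $\delta=\mathrm{Ad}\,P_0|_{\mathfrak h'}\in W'$ is a Coxeter element; it acts on $\Delta'$ by $\delta(\beta)=\beta\circ\mathrm{Ad}(P_0)^{-1}$. Orthogonality of roots is with respect to the form induced by the Killing form. Singular directions: the rays in $\mathbb C$ from $0$ through the points $\beta(-E_+)$, $\beta\in\Delta'$. There are $2s$ of them, equally spaced, labelled $d_1,\dots,d_{2s}$ clockwise. $\mathcal R(d_i)$ is the set of $\beta\in\Delta'$ such that $\beta(-E_+)$ lies on $d_i$. Bipartite Coxeter elements: any set of simple roots $\Pi'$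 of $\Delta'$ has a partition $\Pi'=\Pi_1'\sqcup\Pi_2'$, unique up to the labelling of the two parts, such that the roots in each part are mutually orthogonal. Put $\tau_k=\prod_{\beta\in\Pi'_k}R_\beta$ ($k=1,2$), where $R_\beta$ is the reflection in $\beta$, and $\gamma=\tau_2\tau_1$. Choose $\Pi'$ and the labelling of the partition so that $\gamma=\delta$, and the initial direction $d_1$ so that the positive system $\Delta'_+$ with simple roots $\Pi'$ is $\Delta'_+=\mathcal R(d_1)\sqcup\cdots\sqcup\mathcal R(d_s)$ (such choices are possible). *)

(* Defs.v *)
From HB Require Import structures.
From mathcomp Require Import all_boot all_order all_algebra.
From mathcomp Require Import complex.
From mathcomp Require Import all_classical all_reals all_analysis.

Set Implicit Arguments.
Unset Strict Implicit.
Unset Printing Implicit Defensive.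

Import Order.TTheory GRing.Theory Num.Theory.
Import numFieldNormedType.Exports.
Import passmx.

Local Open Scope classical_set_scope.
Local Open Scope ring_scope.

HB.mixin Record Vector_isLieAlgebra (K : fieldType) g of Vector K g := {
  lie : g -> g -> g;
  lieDl : forall (a : K) (x y z : g),
    lie (a *: x + y) z = a *: lie x z + lie y z;
  lieDr : forall (a : K) (x y z : g),
    lie z (a *: x + y) = a *: lie z x + lie z y;
  liexx : forall x : g, lie x x = 0;
  lie_jacobi : forall x y z : g,
    lie x (lie y z) + lie y (lie z x) + lie z (lie x y) = 0
}.

#[short(type="lieAlgebraType")]
HB.structure Definition LieAlgebra (K : fieldType) :=
  { g of Vector_isLieAlgebra K g & Vector K g }.

Section LieAlgebraDefs.
Variables (K : fieldType) (g : lieAlgebraType K).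
Implicit Types (x y : g) (h k I : {vspace g}).

Definition ad x : 'End(g) := linfun (lie x).

Definition lftrace (f : 'End(g)) : K :=
  \tr (mxof (vbasis {:g}) (vbasis {:g}) f).

Definition killing x y : K := lftrace (ad x \o ad y)%VF.

Definition lie_ideal I : Prop := forall x y, y \in I -> lie x y \in I.

Definition lie_simple : Prop :=
  (exists x y, lie x y != 0) /\
  (forall I, lie_ideal I -> I = 0%VS \/ I = fullv).

Definition lie_abelian h : Prop := {in h &, forall x y, lie x y = 0}.

(* Over an algebraically closed field, semisimple means diagonalizable. *)
Definition ad_semisimple x : Prop :=
  exists b : seq g, basis_of {:g} b /\
    {in b, forall v, exists a : K, lie x v = a *: v}.

(* Cartan subalgebras, in the formulation used for semisimple Lie algebras. *)
Definition cartan_subalgebra h : Prop :=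
  [/\ lie_abelian h,
      forall k, (h <= k)%VS -> lie_abelian k -> k = h
    & {in h, forall x, ad_semisimple x}].

Definition dual h : vectType K := 'Hom(subvs_of h, K^o).

Section Roots.
Variable h : {vspace g}.
Implicit Types (a b phi : dual h) (P : seq (dual h)).

Definition root_vector a x : Prop :=
  forall t : subvs_of h, lie (vsval t) x = (a t : K) *: x.

Definition is_root a : Prop :=
  a != 0 /\ exists2 x, x != 0 & root_vector a x.

(* The element of h representing a through the Killing form, which is
   nondegenerate on a Cartan subalgebra of a simple complex Lie algebra. *)
Definition killing_repr a : subvs_of h :=
  xget 0 [set t : subvs_of h |
           forall u : subvs_of h, killing (vsval t) (vsval u) = a u].

Definition dual_form a b : K :=
  killing (vsval (killing_repr a)) (vsval (killing_repr b)).

Definition reflection b a : dual h :=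
  a - (2 * dual_form a b / dual_form b b) *: b.

(* For [:: b1; ..; bn], the composite R_b1 R_b2 .. R_bn. *)
Definition reflections P : dual h -> dual h :=
  foldr (fun b f => reflection b \o f) id P.

Definition nonneg_comb P a : Prop :=
  exists n : dual h -> nat, a = \sum_(b <- P) b *+ n b.

Definition simple_roots P : Prop :=
  [/\ {in P, forall a, is_root a}, basis_of {:dual h} P
    & forall a, is_root a -> nonneg_comb P a \/ nonneg_comb P (- a)].

Definition positive_roots P : set (dual h) :=
  [set a | is_root a /\ nonneg_comb P a].

Definition highest_root P a : Prop :=
  is_root a /\ forall b, is_root b -> nonneg_comb P (a - b).

Definition mutually_orthogonal (S : set (dual h)) : Prop :=
  forall a b, S a -> S b -> a != b -> dual_form a b = 0.

(* The action beta |-> beta \o (f|h)^-1 on the dual of h of an automorphism f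
   of g preserving h, where finv is the inverse of f. *)
Definition dual_action (finv : 'End(g)) phi : dual h :=
  (phi \o linfun (vsproj h) \o finv \o linfun (@vsval K g h))%VF.

(* alpha_0 = - psi, and alpha_1, .., alpha_l. *)
Definition affine_root l (alpha : 'I_l -> dual h) (psi : dual h)
    (i : 'I_l.+1) : dual h :=
  if unlift ord0 i is Some j then alpha j else - psi.

End Roots.

End LieAlgebraDefs.

Section ComplexDefs.
Variables (R : realType).
Local Notation C := R[i].

(* E = exp D. Convergence in the finite-dimensional space g is convergence of
   all coordinates. *)
Definition is_exp (g : vectType C) (D E : 'End(g)) : Prop :=
  forall (v : g) (phi : 'Hom(g, C^o)),
    (fun n : nat => phi (\sum_(0 <= k < n) (k`!%:R : C)^-1 *: iter k D v) : C^o)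
      @ \oo --> (phi (E v) : C^o).

(* What is used of a complex Lie group G with Lie algebra g: its exponential
   map and its adjoint representation. *)
Record lie_group_with (g : lieAlgebraType C) (G : groupType)
    (expG : g -> G) (Ad : G -> 'End(g)) : Prop := LieGroupWith {
  expG_one_param : forall (a b : C) (x : g),
    expG ((a + b) *: x) = (expG (a *: x) * expG (b *: x))%g;
  Ad1 : Ad 1%g = \1%VF;
  AdM : forall p q : G, Ad (p * q)%g = (Ad p \o Ad q)%VF;
  Ad_lie : forall (p : G) (x y : g), Ad p (lie x y) = lie (Ad p x) (Ad p y);
  Ad_exp : forall x : g, is_exp (ad x) (Ad (expG x))
}.

Definition cis (t : R) : C := (cos t +i* sin t)%C.

(* The ray from 0 through z, without its origin. *)
Definition ray (z : C) : set C := [set w | exists2 t : R, 0 < t & w = t%:C%C * z].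

Section SingularDirections.
Variables (g : lieAlgebraType C) (h : {vspace g}) (E : g).

(* beta(-E), for E in h. *)
Definition root_value (b : dual h) : C := b (vsproj h (- E)).

Definition singular_directions : set (set C) :=
  [set ray (root_value b) | b in [set b : dual h | is_root b]].

Definition direction_roots (d : set C) : set (dual h) :=
  [set b | is_root b /\ d (root_value b)].

(* d 1, .., d N are all the singular directions, each occurring once, in
   clockwise order. *)
Definition clockwise_labelling (N : nat) (d : nat -> set C) : Prop :=
  [set d i | i in [set i | (1 <= i <= N)%N]] = singular_directions /\
  exists theta : nat -> R,
    [/\ forall i, (1 <= i <= N)%N -> d i = ray (cis (- theta i)),
        forall i j, (1 <= i)%N -> (i < j)%N -> (j <= N)%N -> theta i < theta j
      & theta N < theta 1%N + 2 * pi].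

End SingularDirections.

End ComplexDefs.

Arguments root_value {R g} h E b.
Arguments singular_directions {R g} h E.
Arguments direction_roots {R g} h E d.
Arguments clockwise_labelling {R g} h E N d.

(* Main.v *)
Require Import Defs.
From HB Require Import structures.
From mathcomp Require Import all_boot all_order all_algebra.
From mathcomp Require Import complex.
From mathcomp Require Import all_classical all_reals all_analysis.
From mathcomp Require Import zify ring lra.

(* Write S_n for the set of roots on the (n+1)-st singular direction, n being
   extended to all natural numbers by going around the circle.  As Ad P0 E is
   e^(2 pi i / s) E, the Coxeter element gamma rotates the values beta(-E)
   clockwise by 2 pi / s.  A bijection of the 2s directions which preserves
   their cyclic order and whose s-th power is a full turn is the shift by two,
   so gamma S_n = S_(n+2); likewise - S_n = S_(n+s).

   For b in Pi_2' the root gamma^-1 b = - tau_1 b is negative, whence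
   Pi_2' is contained in the union of S_0 and S_1; symmetrically Pi_1' is
   contained in the union of S_(s-2) and S_(s-1).  The directions of S_0 and S_(s-1) are the extreme rays
   of the cone containing the positive roots, so a root of S_0 is a sum of simple
   roots of S_0, hence of Pi_2'; as these are orthogonal it is one of them.
   Symmetrically S_(s-1) is contained in Pi_1'.  If some b in Pi_2' were in S_1,
   then c = tau_1 b, for which gamma c = - b, would be in S_(s-1), hence in
   Pi_1', and b = tau_1 c = - c would be negative.  So S_0 = Pi_2', and
   symmetrically S_(s-1) = Pi_1'; the rest follows by applying gamma and -1.

   Once the Killing form is known to be nondegenerate, the facts needed on root
   systems (one-dimensional root spaces, only +-a among the multiples of a root
   a, stability under reflections) come from the vanishing of the trace of a
   commutator on a subspace stable under both factors. *)

Set Implicit Arguments.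
Unset Strict Implicit.
Unset Printing Implicit Defensive.

Import Order.TTheory GRing.Theory Num.Theory.
Import numFieldNormedType.Exports.
Import passmx.

Local Open Scope classical_set_scope.
Local Open Scope ring_scope.

(** * Brackets, traces and the invariance of the Killing form *)

Section LieBasics.
Variables (K : fieldType) (g : lieAlgebraType K).
Implicit Types (x y z : g) (f : 'End(g)).

Lemma lie_is_linear x : linear (lie x).
Proof. by move=> a y z; rewrite lieDr. Qed.

HB.instance Definition _ x :=
  GRing.isLinear.Build K g g *:%R (lie x) (lie_is_linear x).

Lemma lieC x y : lie x y = - lie y x.
Proof.
apply/eqP; rewrite -addr_eq0; have := liexx (x + y).
have lDl u v w : lie (u + v) w = lie u w + lie v w.
  by have := lieDl 1 u v w; rewrite !scale1r.
by rewrite lDl !linearD /= !liexx add0r addr0 => ->.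
Qed.

Lemma lieZl a x y : lie (a *: x) y = a *: lie x y.
Proof. by rewrite lieC linearZ /= -scalerN -lieC. Qed.

Lemma lieDl1 x y z : lie (x + y) z = lie x z + lie y z.
Proof. by rewrite lieC linearD opprD /= -!lieC. Qed.

Lemma lie_der x y z : lie x (lie y z) = lie (lie x y) z + lie y (lie x z).
Proof.
have /eqP := lie_jacobi x y z; rewrite -addrA addr_eq0 => /eqP ->.
by rewrite opprD addrC (lieC z) opprK (lieC z) linearN opprK.
Qed.

Lemma adE x y : ad x y = lie x y. Proof. by rewrite lfunE. Qed.

Lemma ad_is_linear : linear (@ad K g).
Proof. by move=> a x y; apply/lfunP => z; rewrite add_lfunE scale_lfunE !adE lieDl. Qed.

HB.instance Definition _ :=
  GRing.isLinear.Build K g 'End(g) *:%R (@ad K g) ad_is_linear.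

Lemma ad_lie x y : ad (lie x y) = (ad x \o ad y)%VF - (ad y \o ad x)%VF.
Proof.
apply/lfunP => z.
by rewrite add_lfunE opp_lfunE !comp_lfunE !adE lie_der addrK.
Qed.

Lemma lftrace_is_scalar : scalar (@lftrace K g).
Proof. by move=> a f1 f2; rewrite /lftrace linearP mxtraceD mxtraceZ. Qed.

HB.instance Definition _ :=
  GRing.isLinear.Build K 'End(g) K *%R (@lftrace K g) lftrace_is_scalar.

Lemma lftrace_comp f1 f2 : lftrace (f1 \o f2)%VF = lftrace (f2 \o f1)%VF.
Proof.
by rewrite /lftrace !(mxof_comp _ _ (vbasisP fullv)) mxtrace_mulC.
Qed.

(** The two change-of-basis matrices [M] and [N] are inverse to each other, and the trace is
    invariant under cyclic permutation. Later computations can thus be made in a basis of weight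
    vectors. *)
Lemma lftrace_basis f (B : (\dim {:g}).-tuple g) : basis_of {:g} B ->
  lftrace f = \sum_j coord B j (f B`_j).
Proof.
move=> B_basis; set V := vbasis {:g}; have V_basis : basis_of fullv V := vbasisP _.
pose M := mxof B V \1%VF; pose N := mxof V B \1%VF.
have -> : \sum_j coord B j (f B`_j) = \tr (mxof B B f).
  apply: eq_bigr => j _; rewrite /mxof mxE /= -(rVofE B_basis).
  by rewrite (rVofK B_basis) mxE.
have -> : mxof B B f = M *m mxof V V f *m N.
  rewrite /M /N -(mxof_comp _ _ V_basis) -(mxof_comp _ _ V_basis).
  by rewrite comp_lfun1l comp_lfun1r.
rewrite mxtrace_mulC mulmxA -(mxof_comp _ _ B_basis) comp_lfun1l.
by rewrite (mxof1 (basis_free V_basis)) mul1mx.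
Qed.

Lemma killingC x y : killing x y = killing y x.
Proof. exact: lftrace_comp. Qed.

Lemma killing_is_scalar x : scalar (killing x).
Proof.
move=> a y z; rewrite /killing linearP comp_lfunDr -comp_lfunZr.
by rewrite linearD /= linearZ.
Qed.

HB.instance Definition _ x :=
  GRing.isLinear.Build K g K *%R (killing x) (killing_is_scalar x).

Lemma killing_is_linear x : linear (killing x : g -> K^o).
Proof. exact: killing_is_scalar. Qed.

Lemma killing_lie x y z : killing (lie x y) z = killing x (lie y z).
Proof.
rewrite /killing !ad_lie !(comp_lfunDl, comp_lfunDr, comp_lfunNl, comp_lfunNr).
rewrite !linearB /= -!comp_lfunA; congr (_ - _).
by rewrite lftrace_comp -!comp_lfunA.
Qed.

End LieBasics.

(** Serves functions whose linearity is known as a proposition rather than through a canonical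
    structure. *)
Lemma linear_lfunE (K : fieldType) (U V : vectType K) (f : U -> V) :
  linear f -> linfun f =1 f.
Proof.
move=> f_lin u.
pose F : {linear U -> V} := HB.pack f (GRing.isLinear.Build K U V *:%R f f_lin).
exact: (lfunE F).
Qed.

(** * The root system of a Cartan subalgebra *)

Section WeightBasis.
Variables (K : fieldType) (g : lieAlgebraType K).
Local Notation N := (\dim {:g}).

Lemma ad_semisimple_diagonalizable (x : g) (V : N.-tuple g) :
  basis_of {:g} V -> ad_semisimple x ->
  diagonalizable (mxof V V (ad x)).
Proof.
move=> V_basis [b0 [b0_basis b0_eig]].
have size_b0 : size b0 == N by rewrite (size_basis (X := in_tuple b0) b0_basis).
pose b := Tuple size_b0; have b_basis : basis_of {:g} b := b0_basis.
pose P := mxof b V \1%VF; pose Q := mxof V b \1%VF.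
have PQ : P *m Q = 1%:M.
  rewrite -(mxof_comp _ _ V_basis) comp_lfun1l.
  by rewrite (mxof1 (basis_free b_basis)).
exists P; first by have [] := mulmx1_unit PQ.
have [P_unit _] := mulmx1_unit PQ.
pose d := \row_j coord b j (ad x b`_j).
apply/diagonalizable_forPex; exists d; apply/simmxP => //.
have -> : diag_mx d = mxof b b (ad x).
  apply/matrixP => i j; rewrite !mxE /= -(rVofE b_basis).
  rewrite (rVofK b_basis).
  have [|a] := b0_eig b`_i; first by rewrite mem_nth // size_tuple.
  rewrite adE => ->; rewrite !linearZ /= !coord_free ?(basis_free b_basis) //.
  by rewrite eqxx mulr1 mulr_natr.
by rewrite -!(mxof_comp _ _ V_basis, mxof_comp _ _ b_basis)
  comp_lfun1l comp_lfun1r.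
Qed.

(** The operators [ad x], for [x] in a basis of [h], commute since [h] is abelian and are
    diagonalizable, hence can be diagonalized simultaneously; the rows of the diagonalizing matrix
    are the coordinates of the weight vectors. *)
Lemma exists_weight_basis (h : {vspace g}) : cartan_subalgebra h ->
  exists (B : N.-tuple g) (w : 'I_N -> dual h),
    basis_of {:g} B /\ forall j, root_vector (w j) B`_j.
Proof.
move=> [h_abel _ h_ss]; set V := vbasis {:g}.
have V_basis : basis_of {:g} V := vbasisP _.
pose As := [seq mxof V V (ad x) | x <- vbasis h].
have [|P P_unit P_diag] := (codiagonalizableP As).1.
  split=> [_ _ /mapP[x hx ->] /mapP[y hy ->]|_ /mapP[x hx ->]].
    have xy0 : lie x y = 0 by apply: h_abel; apply: vbasis_mem.
    rewrite /comm_mx -!(mxof_comp _ _ V_basis).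
    have : ad (lie x y) = 0 by rewrite xy0 linear0.
    by rewrite ad_lie => /subr0_eq ->.
  apply: ad_semisimple_diagonalizable => //.
  exact/h_ss/vbasis_mem.
pose B := [tuple vecof V (row j P) | j < N].
have BE (j : 'I_N) : B`_j = vecof V (row j P) by rewrite -tnth_nth tnth_mktuple.
have B_basis : basis_of {:g} B.
  rewrite basisEfree subvf size_tuple leqnn !andbT.
  apply/freeP => k; under eq_bigr do rewrite BE -linearZ.
  rewrite -linear_sum /= => /eqP; rewrite vecof_eq0 // => /eqP.
  have -> : \sum_i k i *: row i P = (\row_i k i) *m P.
    rewrite mulmx_sum_row; apply: eq_bigr => i _; by rewrite mxE.
  move/(congr1 (mulmx^~ (invmx P))); rewrite mulmxK // mul0mx => k0 i.
  by have := congr1 (fun r : 'rV_N => r 0 i) k0; rewrite !mxE.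
have B_eig (j : 'I_N) : {in vbasis h, forall x, exists a, lie x B`_j = a *: B`_j}.
  move=> x hx; have := allP P_diag _ (map_f _ hx) => /=.
  move=> /diagonalizable_forPex[d /(simmxP P_unit) PA].
  exists (d 0 j); rewrite BE -adE (hom_vecof _ V_basis).
  by rewrite -linearZ -row_mul PA row_mul row_diag_mx -scalemxAl -rowE.
(* Reading the weight off as a coordinate makes its linearity in [t] automatic; that it is an
   eigenvalue on all of [h] follows from the case of basis vectors. *)
pose f (j : 'I_N) (t : subvs_of h) : K^o := coord B j (lie (vsval t) B`_j).
have f_lin j : linear (f j).
  by move=> a t u; rewrite /f linearP lieDl linearP.
have B_eig_h (j : 'I_N) (t : subvs_of h) : lie (vsval t) B`_j = f j t *: B`_j.
  have scalar_lie : exists a, lie (vsval t) B`_j = a *: B`_j.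
    rewrite lieC (coord_vbasis (subvsP t)) linear_sum /=.
    have /boolp.choice[a aE] :
        forall i : 'I_(\dim h), exists a, lie (vbasis h)`_i B`_j = a *: B`_j.
      by move=> i; apply: B_eig; rewrite mem_nth ?size_tuple.
    exists (\sum_i coord (vbasis h) i (vsval t) * a i).
    rewrite scaler_suml -sumrN; apply: eq_bigr => i _.
    by rewrite linearZ /= lieC aE scalerN opprK scalerA.
  case: scalar_lie => a ta; rewrite /f ta linearZ /= coord_free ?(basis_free B_basis) //.
  by rewrite eqxx mulr1.
exists B, (fun j => linfun (f j)); split=> // j t.
by rewrite (linear_lfunE (f_lin j)).
Qed.

End WeightBasis.

(** * Weight vectors and nondegeneracy of the Killing form *)

Section RootSpaces.
Variables (K : numFieldType) (g : lieAlgebraType K) (g_simple : lie_simple g).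
Variables (h : {vspace g}) (h_cartan : cartan_subalgebra h).
Local Notation N := (\dim {:g}).
Variables (B : N.-tuple g) (w : 'I_N -> dual h).
Hypotheses (B_basis : basis_of {:g} B)
  (B_root : forall j : 'I_N, root_vector (w j) B`_j).
Implicit Types (x y : g) (t u : subvs_of h) (a b : dual h).

Lemma lie_basis_sum x y : lie x y = \sum_j coord B j y *: lie x B`_j.
Proof.
rewrite [in LHS](coord_basis B_basis (memvf y)) linear_sum /=.
by apply: eq_bigr => j _; rewrite linearZ.
Qed.

Lemma coord_lie_cartan t x (j : 'I_N) :
  coord B j (lie (vsval t) x) = w j t * coord B j x.
Proof.
rewrite lie_basis_sum linear_sum (bigD1 j) //= big1 => [|k ne_kj].
  rewrite B_root !linearZ /= coord_free ?(basis_free B_basis) // eqxx.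
  by rewrite addr0 mulr1 mulrC.
rewrite B_root !linearZ /= coord_free ?(basis_free B_basis) //.
by rewrite (negPf ne_kj) !mulr0.
Qed.

Lemma coord_inj x y : (forall j, coord B j x = coord B j y) -> x = y.
Proof.
move=> xy; rewrite (coord_basis B_basis (memvf x)) (coord_basis B_basis (memvf y)).
by apply: eq_bigr => j _; rewrite xy.
Qed.

Lemma coord_root_vector a x (j : 'I_N) :
  root_vector a x -> coord B j x != 0 -> w j = a.
Proof.
move=> ax xj_neq0; apply/lfunP => t; apply: (mulIf xj_neq0).
by rewrite -coord_lie_cartan ax linearZ.
Qed.

(** If [x] commutes with [h], then [h + <[x]>] is abelian, so it equals [h] by maximality. *)
Lemma root_vector0P x : reflect (root_vector (0 : dual h) x) (x \in h).
Proof.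
have [h_abel h_max _] := h_cartan.
apply: (iffP idP) => [hx t|x0].
  by rewrite zero_lfunE scale0r h_abel ?subvsP.
have x_comm y : y \in h -> lie y x = 0.
  by move=> hy; have := x0 (Subvs hy); rewrite zero_lfunE scale0r.
rewrite -(h_max (h + <[x]>)%VS) ?addvSl //.
  by rewrite -{1}[x]add0r; apply: memv_add; rewrite ?mem0v ?memv_line.
move=> _ _ /memv_addP[y hy [_ /vlineP[k ->] ->]]
  /memv_addP[z hz [_ /vlineP[m ->] ->]].
rewrite lieDl1 !linearD /= h_abel // !linearZ /= !lieZl liexx x_comm //.
by rewrite (lieC x) x_comm // oppr0 !scaler0 !addr0.
Qed.

Lemma is_rootP a : is_root a <-> a != 0 /\ exists j, w j = a.
Proof.
split=> [[a_neq0 [x x_neq0 ax]]|[a_neq0 [j wj]]]; split=> //.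
  have [j xj|x0] := pickP (fun j => coord B j x != 0).
    by exists j; apply: coord_root_vector ax xj.
  case/eqP: x_neq0; apply: coord_inj => j; rewrite linear0.
  by apply/eqP; have /negbFE := x0 j.
exists B`_j; last by rewrite -wj; exact: B_root.
by apply: (basis_not0 B_basis); rewrite mem_nth ?size_tuple.
Qed.

Lemma root_vector_lie a b x y :
  root_vector a x -> root_vector b y -> root_vector (a + b) (lie x y).
Proof.
move=> ax bY t; rewrite lie_der ax bY add_lfunE scalerDl lieZl.
by rewrite linearZ.
Qed.

Lemma killing_basis x y : killing x y = \sum_j coord B j (lie x (lie y B`_j)).
Proof.
by rewrite /killing (lftrace_basis _ B_basis); apply: eq_bigr => j _;
  rewrite comp_lfunE !adE.
Qed.

(** The operator [ad x \o ad y] raises weights by [a + b], so its matrix in the weight basis has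
    zero diagonal. *)
Lemma killing_root_vector a b x y : root_vector a x -> root_vector b y ->
  a + b != 0 -> killing x y = 0.
Proof.
move=> ax bY ab_neq0; rewrite killing_basis big1 // => j _.
apply/eqP; apply: contraNT ab_neq0 => /(coord_root_vector
  (root_vector_lie ax (root_vector_lie bY (B_root j)))) /eqP.
by rewrite addrA eq_sym -subr_eq0 addrK.
Qed.

Lemma killing_cartan t u :
  killing (vsval t) (vsval u) = \sum_j w j t * w j u :> K.
Proof.
rewrite killing_basis; apply: eq_bigr => j _.
rewrite coord_lie_cartan B_root linearZ /= coord_free ?(basis_free B_basis) //.
by rewrite eqxx mulr1.
Qed.

Section Simple.
Variables (P : seq (dual h)) (P_simple : simple_roots P).

(* The values of the roots at such a [t] are integers, so the Killing form,
   [\sum_j (w_j t)^2] at [t], cannot be identically zero. *)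
Lemma exists_height : exists t : subvs_of h, {in P, forall b, b t = 1 :> K}.
Proof.
have [_ P_basis _] := P_simple.
set e := vbasis {:subvs_of h}; have e_basis := vbasisP {:subvs_of h}.
set n := \dim {:subvs_of h} in e *.
pose M := \matrix_(i < size P, j < n) (P`_i e`_j : K).
have evE (b : dual h) (c : 'I_n -> K) :
    b (\sum_j c j *: e`_j) = \sum_j c j * (b e`_j : K) :> K.
  by rewrite linear_sum; apply: eq_bigr => j _; rewrite linearZ.
(* The rows of [M] are the coordinates of the independent forms in [P]. A right inverse [Q], applied
   to the column of ones, gives the coordinates of [t]. *)
have /row_freeP[Q MQ] : row_free M.
  apply: inj_row_free => v vM0; apply/rowP => i; rewrite mxE.
  apply: (elimT (freeP (X := in_tuple P)) (basis_free P_basis) (v 0)).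
  apply/lfunP => t; rewrite (coord_basis e_basis (memvf t)) evE zero_lfunE.
  apply: big1 => j _; rewrite sum_lfunE.
  have /rowP/(_ j) := vM0; rewrite !mxE => vMj.
  apply/eqP; rewrite mulf_eq0; apply/orP; right; apply/eqP.
  rewrite -[RHS]vMj; apply: eq_bigr => k _; by rewrite scale_lfunE mxE.
exists (\sum_j (Q *m const_mx 1 : 'cV_n) j 0 *: e`_j) => b bP.
have bE : b = P`_(Ordinal (m := index b P) (n := size P) (etrans (index_mem b P) bP)).
  by rewrite /= nth_index.
have /colP/(_ (Ordinal (etrans (index_mem b P) bP))) :
    M *m (Q *m const_mx 1) = const_mx 1 :> 'cV_(size P).
  by rewrite mulmxA MQ mul1mx.
rewrite evE !mxE => bM; rewrite -[RHS]bM; apply: eq_bigr => j _.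
by rewrite [in RHS]mxE /= nth_index // mulrC.
Qed.

Lemma nonneg_comb_height t a : {in P, forall b, b t = 1 :> K} ->
  nonneg_comb P a -> a != 0 -> exists m : nat, a t = m.+1%:R :> K.
Proof.
move=> tP [m ->] a_neq0; have [m0|m_gt0] := posnP (\sum_(b <- P) m b)%N.
  case/eqP: a_neq0; rewrite big_seq big1 // => b bP.
  move/eqP: m0; rewrite sum_nat_seq_eq0 => /allP/(_ b bP)/eqP /= ->.
  by rewrite mulr0n.
exists (\sum_(b <- P) m b)%N.-1; rewrite prednK //.
rewrite sum_lfunE natr_sum !big_seq; apply: eq_bigr => b bP.
by rewrite -scaler_nat scale_lfunE tP //; exact: mulr1.
Qed.

(** The radical of the Killing form is an ideal, hence zero or everything. In the second case the
    real numbers [w j t], for [t] given by [exists_height], have squares of sum zero; all weights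
    then vanish, so the algebra equals the abelian [h], which simplicity excludes. *)
Lemma killing_nondegenerate x : (forall y, killing x y = 0) -> x = 0.
Proof.
move=> x_rad.
have [_ _ root_sign] := P_simple; have [[y0 [z0 yz_neq0]] ideals] := g_simple.
pose F x1 : 'Hom(g, K^o) := linfun (killing x1).
have FxE x1 y1 : F x1 y1 = killing x1 y1.
  by rewrite (linear_lfunE (@killing_is_linear _ _ x1)).
have F_lin : linear F.
  move=> k y z; apply/lfunP => v.
  by rewrite add_lfunE scale_lfunE !FxE !(killingC _ v) linearP.
have FE := linear_lfunE F_lin.
have rad_ideal : lie_ideal (lker (linfun F)).
  move=> y z; rewrite !memv_ker !FE => /eqP z_rad; apply/eqP/lfunP => v.
  rewrite zero_lfunE FxE lieC -scaleN1r killingC linearZ /= killingC.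
  by rewrite killing_lie; rewrite -FxE z_rad zero_lfunE mulr0.
have [rad0|rad_full] := ideals _ rad_ideal.
  apply/eqP; rewrite -memv0 -rad0 memv_ker FE; apply/eqP/lfunP => v.
  by rewrite zero_lfunE FxE x_rad.
have kill0 y z : killing y z = 0.
  have := memvf y; rewrite -rad_full memv_ker FE => /eqP yr0.
  by rewrite -FxE yr0 zero_lfunE.
have [t tP] := exists_height.
have w_height j : w j != 0 -> exists m : nat, `|w j t : K| = m.+1%:R.
  move=> wj_neq0; have : is_root (w j) by apply/is_rootP; split=> //; exists j.
  case/root_sign => /(nonneg_comb_height tP)[] //; last 2 first.
  - by rewrite oppr_eq0.
  - by move=> m; rewrite opp_lfunE => mE; exists m; rewrite -normrN mE normr_nat.
  by move=> m mE; exists m; rewrite mE normr_nat.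
have w_real j : (w j t : K) \is Num.real.
  have [->|wj_neq0] := eqVneq (w j) 0; first by rewrite zero_lfunE real0.
  have : is_root (w j) by apply/is_rootP; split=> //; exists j.
  case/root_sign => /(nonneg_comb_height tP)[] //; last 2 first.
  - by rewrite oppr_eq0.
  - by move=> m; rewrite opp_lfunE -realN => ->; rewrite realn.
  by move=> m ->; rewrite realn.
have w0 j : w j = 0.
  apply/eqP; apply: contraTT isT => /w_height[m /eqP].
  have /eqP := killing_cartan t t; rewrite kill0 eq_sym psumr_eq0 => [|k _].
    move=> /allP/(_ j (mem_index_enum _)); rewrite implyTb mulf_eq0 orbb => /eqP ->.
    by rewrite normr0 eq_sym pnatr_eq0.
  by rewrite -expr2 real_exprn_even_ge0.
case/eqP: yz_neq0.
have in_h x1 : x1 \in h.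
  rewrite (coord_basis B_basis (memvf x1)); apply: memv_suml => j _.
  by apply/memvZ/root_vector0P; rewrite -(w0 j); apply: B_root.
by have [h_abel _ _] := h_cartan; apply: h_abel.
Qed.

End Simple.
End RootSpaces.

(** * Duality through the Killing form, and traces of commutators *)

Section RootSystem.
Variables (K : numFieldType) (g : lieAlgebraType K).
Variables (h : {vspace g}) (h_cartan : cartan_subalgebra h).
Local Notation N := (\dim {:g}).
Variables (B : N.-tuple g) (w : 'I_N -> dual h).
Hypotheses (B_basis : basis_of {:g} B)
  (B_root : forall j : 'I_N, root_vector (w j) B`_j)
  (killing_nondeg : forall x : g, (forall y, killing x y = 0) -> x = 0).
Implicit Types (x y : g) (t u : subvs_of h) (a b c : dual h).

(** Elements of [h] are already orthogonal to all weight vectors of nonzero weight. *)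
Lemma killing_cartan_nondegenerate t :
  (forall u, killing (vsval t) (vsval u) = 0) -> t = 0.
Proof.
move=> t_rad; apply: subvs_inj; apply: killing_nondeg => y.
rewrite (coord_basis B_basis (memvf y)) linear_sum big1 // => j _.
rewrite linearZ /=; have [wj0|wj_neq0] := eqVneq (w j) 0.
  have hBj : B`_j \in h by apply/(root_vector0P h_cartan); rewrite -wj0.
  by rewrite -(vsprojK hBj) t_rad mulr0.
have t0 : root_vector (0 : dual h) (vsval t).
  exact/(root_vector0P h_cartan)/subvsP.
by rewrite (killing_root_vector B_basis B_root t0 (B_root j)) ?add0r // mulr0.
Qed.

(** The map from [h] to its dual given by the Killing form is injective by nondegeneracy, hence onto
    by equality of dimensions; so the default value in [killing_repr] never occurs. *)
Lemma killing_reprP a u : killing (vsval (killing_repr a)) (vsval u) = a u.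
Proof.
pose F t : dual h := linfun ((killing (vsval t) \o vsval) : subvs_of h -> K^o).
have FE t v : F t v = killing (vsval t) (vsval v).
  rewrite linear_lfunE // => k v1 v2 /=; exact: killing_is_linear.
have F_lin : linear F.
  move=> k t1 t2; apply/lfunP => v; rewrite add_lfunE scale_lfunE !FE.
  by rewrite !(killingC _ (vsval v)) killing_is_linear.
have F_ker : (fullv :&: lker (linfun F))%VS = 0%VS.
  apply/eqP; rewrite capfv -subv0; apply/subvP => t; rewrite memv_ker memv0.
  rewrite (linear_lfunE F_lin) => /eqP Ft0; apply/eqP.
  by apply: killing_cartan_nondegenerate => v; rewrite -FE Ft0 zero_lfunE.
have F_img : (limg (linfun F) = fullv)%VS.
  apply/eqP; rewrite eqEdim subvf (limg_dim_eq F_ker) !dimvf /=.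
  by rewrite -[X in (X <= _)%N]/(_ * 1)%N muln1.
have /memv_imgP[t _] : a \in limg (linfun F) by rewrite F_img memvf.
rewrite (linear_lfunE F_lin) => aE.
have := @xgetPex _ (0 : subvs_of h) [set t : subvs_of h |
           forall u : subvs_of h, killing (vsval t) (vsval u) = a u].
by apply; exists t => v; rewrite aE FE.
Qed.

Lemma dual_formE a b : dual_form a b = a (killing_repr b).
Proof. exact: killing_reprP. Qed.

Lemma dual_formC a b : dual_form a b = dual_form b a.
Proof. exact: killingC. Qed.

Lemma dual_form_linear b : scalar (fun a : dual h => dual_form a b).
Proof. by move=> k a1 a2; rewrite !dual_formE add_lfunE scale_lfunE. Qed.

(** Coordinate form of the stability under [ad x] of the span of the basis vectors indexed by
    [J]. *)
Definition stabilizes (J : {pred 'I_N}) x :=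
  forall j k : 'I_N, j \in J -> coord B k (lie x B`_j) != 0 -> k \in J.

(** On a stable span, the restrictions of [ad x] and [ad y] multiply like their blocks of
    coordinates, so both products have the same trace. *)
Lemma partial_trace_commutator (J : {pred 'I_N}) x y :
    stabilizes J x -> stabilizes J y ->
  \sum_(j in J) coord B j (lie (lie x y) B`_j) = 0.
Proof.
move=> xJ yJ.
have lie2 z1 z2 : stabilizes J z2 ->
    \sum_(j in J) coord B j (lie z1 (lie z2 B`_j)) =
    \sum_(j in J) \sum_(k in J) coord B k (lie z2 B`_j) * coord B j (lie z1 B`_k).
  move=> zJ; apply: eq_bigr => j jJ.
  rewrite [X in coord _ _ X](lie_basis_sum B_basis) linear_sum /=.
  rewrite [RHS]big_mkcond; apply: eq_bigr => k _; rewrite linearZ /=.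
  case: ifPn => // kJ; have [->|/(zJ _ _ jJ)] := eqVneq (coord B k (lie z2 B`_j)) 0.
    by rewrite mul0r.
  by rewrite (negPf kJ).
under eq_bigr => j _ do rewrite -adE ad_lie add_lfunE opp_lfunE !comp_lfunE !adE linearB.
rewrite sumrB !lie2 // exchange_big /=; apply/eqP; rewrite subr_eq0; apply/eqP.
by apply: eq_bigr => j _; apply: eq_bigr => k _; rewrite mulrC.
Qed.

Lemma weight_lie_basis (i j k : 'I_N) :
  coord B k (lie B`_i B`_j) != 0 -> w k = w i + w j.
Proof.
exact/(coord_root_vector B_basis B_root)/(root_vector_lie (B_root i) (B_root j)).
Qed.

(** Nondegeneracy gives a basis vector not orthogonal to that of index [i]; its weight must be
    [- w i]. The bracket then lies in [h], and invariance of the form identifies it by its pairing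
    with [h]. *)
Lemma opposite_root_pair (i : 'I_N) : w i != 0 -> exists k : 'I_N, w k = - w i /\
  exists2 c : K, c != 0 & lie B`_i B`_k = c *: vsval (killing_repr (w i)).
Proof.
move=> wi_neq0.
have [k ik_neq0] : exists k : 'I_N, killing B`_i B`_k != 0.
  have [k ?|ik0] := pickP (fun k : 'I_N => killing B`_i B`_k != 0); first by exists k.
  have Bi_neq0 : B`_i != 0.
    by apply: (basis_not0 B_basis); rewrite mem_nth ?size_tuple.
  case/eqP: Bi_neq0; apply: killing_nondeg => y.
  rewrite (coord_basis B_basis (memvf y)) linear_sum big1 // => k _.
  by rewrite linearZ /=; have /negbFE/eqP -> := ik0 k; rewrite mulr0.
have wk : w k = - w i.
  apply/eqP; rewrite eq_sym -subr_eq0 -opprD oppr_eq0.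
  apply: contraNT ik_neq0 => ik_neq0; apply/eqP.
  exact: (killing_root_vector B_basis B_root (B_root i) (B_root k)).
exists k; split=> //; exists (killing B`_i B`_k) => //.
have ik_h : lie B`_i B`_k \in h.
  apply/(root_vector0P h_cartan); rewrite -(subrr (w i)) -wk.
  exact: (root_vector_lie (B_root i) (B_root k)).
rewrite -(vsprojK ik_h) -linearZ; congr vsval; apply/eqP; rewrite -subr_eq0.
apply/eqP/killing_cartan_nondegenerate => u.
rewrite linearB /= killingC linearB linearZ /= vsprojK //.
rewrite !(killingC (vsval u)) killing_reprP killing_lie lieC B_root wk.
by rewrite opp_lfunE scaleNr opprK linearZ /= mulrC subrr.
Qed.

Lemma root_opp a : is_root a -> is_root (- a).
Proof.
move=> /(is_rootP B_basis B_root)[a_neq0 [i wi]]; apply/(is_rootP B_basis B_root).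
split; first by rewrite oppr_eq0.
by have [|k [wk _]] := @opposite_root_pair i; [|exists k]; rewrite ?wk wi.
Qed.

(** Up to the factor [c], the element representing [a] is a commutator, and it acts diagonally with
    entries the weights. *)
Lemma partial_trace_root (i k : 'I_N) a (c : K) (J : {pred 'I_N}) :
    c != 0 -> lie B`_i B`_k = c *: vsval (killing_repr a) ->
    stabilizes J B`_i -> stabilizes J B`_k ->
  \sum_(j in J) w j (killing_repr a) = 0 :> K.
Proof.
move=> c_neq0 ik iJ kJ; have := partial_trace_commutator iJ kJ.
under eq_bigr => j _ do rewrite ik lieZl linearZ /= (coord_lie_cartan B_basis B_root)
  coord_free ?(basis_free B_basis) // eqxx mulr1.
by rewrite -mulr_sumr => /eqP; rewrite mulf_eq0 (negPf c_neq0) => /eqP.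
Qed.

(* If [a t_a = 0], then a weight takes the same value at [t_a] on all of its
   translates by multiples of [a]; that value is zero since [t_a] has trace zero
   on the sum of their weight spaces. *)
Lemma dual_form_root_neq0 a : is_root a -> dual_form a a != 0.
Proof.
move=> /(is_rootP B_basis B_root)[a_neq0 [i wi]]; rewrite dual_formE.
set t := killing_repr a; apply/eqP => at0.
have [|k [wk [c c_neq0 ik]]] := @opposite_root_pair i; first by rewrite wi.
rewrite wi -/t in wk ik.
have w0 j : w j t = 0 :> K.
  pose J : {pred 'I_N} := [pred m | `[< exists n : int, w m = w j + a *~ n >]].
  have jJ : j \in J by apply/asboolP; exists 0; rewrite mulr0z addr0.
  have := partial_trace_root c_neq0 ik (J := J).
  have iJ : stabilizes J B`_i.
    move=> m n /asboolP[z mz] /weight_lie_basis; rewrite wi mz => nE.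
    by apply/asboolP; exists (z + 1); rewrite nE mulrzDr mulr1z addrCA (addrC a).
  have kJ : stabilizes J B`_k.
    move=> m n /asboolP[z mz] /weight_lie_basis; rewrite wk mz => nE.
    by apply/asboolP; exists (z - 1); rewrite nE mulrzBr mulr1z addrCA (addrC (- a)).
  move=> /(_ iJ kJ); rewrite (eq_bigr (fun=> w j t : K)) => [|m /asboolP[z ->]].
    rewrite sumr_const => /eqP; rewrite mulrn_eq0 => /orP[|/eqP //].
    by rewrite (cardD1 j) jJ.
  by rewrite add_lfunE -scaler_int scale_lfunE at0 scaler0 addr0.
case/eqP: a_neq0; apply/lfunP => u; rewrite zero_lfunE -killing_reprP -/t.
suff -> : t = 0 by rewrite killingC linear0.
apply: killing_cartan_nondegenerate => v.
by rewrite (killing_cartan B_basis B_root) big1 // => j _; rewrite w0 mul0r.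
Qed.

End RootSystem.

Section RootStrings.
Variables (K : numFieldType) (g : lieAlgebraType K).
Variables (h : {vspace g}) (h_cartan : cartan_subalgebra h).
Local Notation N := (\dim {:g}).
Variables (B : N.-tuple g) (w : 'I_N -> dual h).
Hypotheses (B_basis : basis_of {:g} B)
  (B_root : forall j : 'I_N, root_vector (w j) B`_j)
  (killing_nondeg : forall x : g, (forall y, killing x y = 0) -> x = 0).
Implicit Types (x y : g) (t u : subvs_of h) (a b c : dual h).

(* The trace of [t_a] is zero on the span of one root vector for [-a], of [h]
   and of the root spaces of the positive multiples of [a]: dividing by [a t_a],
   the multiplicities [m_k] of the roots [k a] satisfy [\sum_(k > 0) k m_k = 1]. *)
Lemma root_ladder (i : 'I_N) : w i != 0 ->
  forall (j : 'I_N) (m : nat), w j = w i *+ m.+1 -> j = i.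
Proof.
move=> wi_neq0.
have [k [wk [c c_neq0 ik]]] :=
  opposite_root_pair h_cartan B_basis B_root killing_nondeg wi_neq0.
set a := w i in wi_neq0 wk ik *; set t := killing_repr a in ik.
have at_neq0 : a t != 0 :> K.
  rewrite -(dual_formE h_cartan B_basis B_root killing_nondeg).
  apply: (dual_form_root_neq0 h_cartan B_basis B_root killing_nondeg).
  by apply/(is_rootP B_basis B_root); split=> //; exists i.
have mul_at m : (a *+ m) t = m%:R * a t :> K by rewrite -scaler_nat scale_lfunE.
pose mult j := exists m, w j = a *+ m.
(* For weights that are not multiples of [a], the value of [m] is a default. *)
have /boolp.choice[m mE] : forall j, exists m, mult j -> w j = a *+ m.
  by move=> j; have [[m ?]|] := pselect (mult j); [exists m | exists 0%N].
have wk_not_mult : ~ mult k.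
  move=> [n]; rewrite wk => /eqP; rewrite eqr_oppLR -subr_eq0 opprK => /eqP anE.
  have /eqP : (a + a *+ n) t = 0 :> K by rewrite anE zero_lfunE.
  by rewrite -mulrS mul_at mulf_eq0 (negPf at_neq0) pnatr_eq0.
pose J : {pred 'I_N} := [pred j | (j == k) || `[< mult j >]].
have iJ : stabilizes B J B`_i.
  move=> j n jJ /(weight_lie_basis B_basis B_root) nE; apply/orP; right; apply/asboolP.
  case/orP: jJ => [/eqP jk|/asboolP[p jp]].
    by exists 0%N; rewrite nE jk wk subrr.
  by exists p.+1; rewrite nE jp mulrS.
(* The vector of index [k] commutes with itself, sends [h] into its own line, and lowers the
   positive multiples of [a] by one. *)
have kJ : stabilizes B J B`_k.
  move=> j n /orP[/eqP ->|/asboolP[[|p] jp]]; first by rewrite liexx linear0 eqxx.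
    have hBj : B`_j \in h by apply/(root_vector0P h_cartan); rewrite -[0]jp; apply: B_root.
    rewrite lieC -(vsprojK hBj) B_root -scalerN linearZ linearN /=.
    rewrite coord_free ?(basis_free B_basis) //.
    have [->|ne_nk] := eqVneq n k; first by move=> _; rewrite inE eqxx.
    by rewrite ?oppr0 ?mulr0 ?oppr0 eqxx.
  move=> /(weight_lie_basis B_basis B_root); rewrite wk jp mulrS addKr => nE.
  by apply/orP; right; apply/asboolP; exists p.
have := partial_trace_root B_basis B_root c_neq0 ik iJ kJ.
rewrite (bigD1 k) /=; last by rewrite inE eqxx.
rewrite wk opp_lfunE => /eqP; rewrite addrC subr_eq0 => /eqP.
pose J' := [pred j | `[< mult j >]].
rewrite (eq_bigl (mem J')) => [|j]; last first.
  rewrite !inE; have [->|//] := eqVneq j k; last by rewrite andbT.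
  by rewrite andbF; symmetry; apply/asboolP.
rewrite (eq_bigr (fun j => (m j)%:R * a t)) => [|j /asboolP /mE {1}->]; last exact: mul_at.
rewrite -mulr_suml -{2}[a t : K]mul1r => /(mulIf at_neq0) /eqP.
rewrite -natr_sum pnatr_eq1 (bigD1 i) /=; last by apply/asboolP; exists 1%N.
have mi1 : m i = 1%N.
  have := mE i (ex_intro _ 1%N (erefl _)); rewrite -/a => aE.
  have /eqP : (a *+ 1) t = (a *+ m i) t :> K by rewrite -aE.
  by rewrite !mul_at (inj_eq (mulIf at_neq0)) eqr_nat => /eqP.
rewrite mi1 add1n eqSS sum_nat_eq0 => /forallP mj0 j p wj.
apply/eqP; apply: contraT => ne_ji.
have multj : mult j by exists p.+1.
have := mj0 j; rewrite ne_ji andbT => /implyP; rewrite inE => /(_ multj) /eqP mj.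
have := mE _ multj; rewrite mj mulr0n wj => ap0.
have /eqP : (a *+ p.+1) t = 0 :> K by rewrite ap0 zero_lfunE.
by rewrite mul_at mulf_eq0 (negPf at_neq0) pnatr_eq0.
Qed.

End RootStrings.

Lemma vect_mulrIn (K : numFieldType) (V : lmodType K) (v : V) :
  v != 0 -> injective (GRing.natmul v).
Proof.
move=> v_neq0 m n /eqP; rewrite -!(scaler_nat _ v) -subr_eq0 -scalerBl.
by rewrite scaler_eq0 (negPf v_neq0) orbF subr_eq0 eqr_nat => /eqP.
Qed.

(** * Root strings and stability of the roots under reflections *)

Section RootReflections.
Variables (K : numFieldType) (g : lieAlgebraType K).
Variables (h : {vspace g}) (h_cartan : cartan_subalgebra h).
Local Notation N := (\dim {:g}).
Variables (B : N.-tuple g) (w : 'I_N -> dual h).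
Hypotheses (B_basis : basis_of {:g} B)
  (B_root : forall j : 'I_N, root_vector (w j) B`_j)
  (killing_nondeg : forall x : g, (forall y, killing x y = 0) -> x = 0).
Implicit Types (x y : g) (t u : subvs_of h) (a b c : dual h).

(** This says that root spaces are lines. *)
Lemma weight_inj (i j : 'I_N) : w i != 0 -> w j = w i -> j = i.
Proof.
move=> wi_neq0 wji.
exact: (root_ladder h_cartan B_basis B_root killing_nondeg wi_neq0 (m := 0)).
Qed.

Lemma root_mulrn a m : is_root a -> is_root (a *+ m) -> m = 1%N.
Proof.
case: m => [|m]; first by rewrite mulr0n => _ [/eqP].
move=> /(is_rootP B_basis B_root)[a_neq0 [i wi]] /(is_rootP B_basis B_root)[_ [j wj]].
have wi_neq0 : w i != 0 by rewrite wi.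
have ji : j = i.
  apply: (root_ladder h_cartan B_basis B_root killing_nondeg wi_neq0 (m := m)).
  by rewrite wi.
by move: wj; rewrite ji wi => /(@vect_mulrIn _ _ _ a_neq0 1 m.+1) <-.
Qed.

(** An endless chain would give infinitely many distinct weights, but they are indexed by ['I_N]. *)
Lemma root_chain_end c b : is_root c -> b != 0 -> exists q : nat,
  (forall k, (k <= q)%N -> is_root (c + b *+ k)) /\ ~ is_root (c + b *+ q.+1).
Proof.
move=> c_root b_neq0; apply: contrapT => no_end.
have roots k : is_root (c + b *+ k).
  suff H : forall j, (j <= k)%N -> is_root (c + b *+ j) by apply: H.
  elim: k => [|k IHk] j; first by rewrite leqn0 => /eqP ->; rewrite mulr0n addr0.
  rewrite leq_eqVlt => /orP[/eqP ->|]; last exact: IHk.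
  by apply: contrapT => nroot; apply: no_end; exists k.
have /boolp.choice[f fE] : forall k, exists j, w j = c + b *+ k.
  by move=> k; have /(is_rootP B_basis B_root)[_] := roots k.
have f_inj : injective (fun k : 'I_N.+1 => f k).
  move=> k1 k2 /(congr1 w); rewrite !fE => /addrI/(vect_mulrIn b_neq0).
  exact: val_inj.
by have := leq_card _ f_inj; rewrite !card_ord ltnn.
Qed.

(* The trace of [t_a] on the [a]-string through [c], whose root spaces are
   lines, is zero: this forces [2 (c, a) / (a, a)] to be the length of the string
   below [c] minus its length above [c]. *)
Lemma reflection_root a c : is_root a -> is_root c -> is_root (reflection a c).
Proof.
move=> a_root c_root; have [a_neq0 _] := a_root; have [c_neq0 _] := c_root.
have aa_neq0 := dual_form_root_neq0 h_cartan B_basis B_root killing_nondeg a_root.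
have opp_root := root_opp h_cartan B_basis B_root killing_nondeg.
have formE := dual_formE h_cartan B_basis B_root killing_nondeg.
have refl_a : reflection a a = - a.
  by rewrite /reflection mulfK // scaler_nat mulr2n opprD addNKr.
(* Multiples of [a] are set apart: their string passes through the weight zero, whose space [h] need
   not be a line. *)
have [[n cE]|c_notZ] := pselect (exists n : int, c = a *~ n).
  case: n cE => n cE; move: c_root; rewrite cE.
    rewrite -pmulrn => c_root; rewrite (root_mulrn a_root c_root) mulr1n refl_a.
    exact: opp_root.
  rewrite NegzE mulrNz -pmulrn => /opp_root; rewrite opprK => /(root_mulrn a_root) ->.
  rewrite mulr1n /reflection formE opp_lfunE -formE mulrN mulNr mulfK //.
  by rewrite scaleNr opprK scaler_nat mulr2n addKr.
have [q [q_root q_end]] := root_chain_end c_root (b := - a) ltac:(by rewrite oppr_eq0).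
have [p [p_root p_end]] := root_chain_end c_root a_neq0.
(* [c'] is the lower end of the string, which has [n.+1] members: [q] below [c], [c] itself, and [p]
   above. *)
pose c' := c - a *+ q; pose n := (q + p)%N.
have c'E k : c' + a *+ k = c + a *~ (k%:Z - q%:Z).
  by rewrite mulrzBr /c' -!pmulrn addrAC addrA.
have string k : (k <= n)%N -> is_root (c' + a *+ k).
  move=> k_n; have [k_q|q_k] := leqP k q.
    have := q_root (q - k)%N (leq_subr _ _).
    by rewrite mulNrn mulrnBr // opprB addrA addrAC.
  have := p_root (k - q)%N; rewrite leq_subLR => /(_ k_n).
  by rewrite mulrnBr 1?ltnW // addrA addrAC.
have /boolp.choice[f fE] : forall k : 'I_n.+1, exists j, w j = c' + a *+ k.
  by move=> k; have /(is_rootP B_basis B_root)[] := string k (ltn_ord k).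
have f_inj : injective f.
  move=> k1 k2 /(congr1 w); rewrite !fE => /addrI/(vect_mulrIn a_neq0).
  exact: val_inj.
have string_neq0 (z : int) : c + a *~ z != 0.
  apply/eqP => cz; apply: c_notZ; exists (- z); apply/eqP.
  by rewrite mulrNz -subr_eq0 opprK cz.
have weight_root (j : 'I_N) (z : int) : w j = c + a *~ z -> is_root (c + a *~ z).
  by move=> wj; apply/(is_rootP B_basis B_root); split=> //; exists j.
have [i wi] : exists i, w i = a by have /(is_rootP B_basis B_root)[] := a_root.
have wi_neq0 : w i != 0 by rewrite wi.
have [m [wm [k k_neq0 ik]]] :=
  opposite_root_pair h_cartan B_basis B_root killing_nondeg wi_neq0.
rewrite wi in wm ik; set t := killing_repr a in ik.
pose J := (f @: 'I_n.+1)%SET.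
have fJ j (x : 'I_n.+1) : w j = c' + a *+ x -> j \in J.
  move=> jx; apply/imsetP; exists x => //; apply: weight_inj; last by rewrite fE.
  by rewrite fE c'E.
have iJ : stabilizes B (mem J) B`_i.
  move=> _ j /imsetP[x _ ->] /(weight_lie_basis B_basis B_root).
  rewrite wi fE addrCA -mulrS => jE.
  have [x_n|n_x] := ltnP x.+1 n.+1; first exact: (fJ _ (Ordinal x_n)).
  case: p_end; move: jE; have -> : nat_of_ord x = n.
    by apply/eqP; rewrite eqn_leq -ltnS ltn_ord -ltnS.
  have -> : c' + a *+ n.+1 = c + a *~ p.+1%:Z.
    by rewrite c'E /n -addnS PoszD addrAC subrr add0r.
  by move=> /weight_root; rewrite -pmulrn.
have mJ : stabilizes B (mem J) B`_m.
  move=> _ j /imsetP[x _ ->] /(weight_lie_basis B_basis B_root).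
  rewrite wm fE addrCA; case: x => -[|x] x_n /=; last first.
    by rewrite mulrS addKr => jE; apply: (fJ _ (Ordinal (ltnW x_n))).
  move=> jE; case: q_end; move: jE.
  have -> : c' + (- a + a *+ 0) = c + a *~ - q.+1%:Z.
    by rewrite mulr0n addr0 /c' mulrNz -pmulrn mulrS opprD addrA addrAC.
  by move=> /weight_root; rewrite mulrNz -pmulrn -mulNrn.
have := partial_trace_root B_basis B_root k_neq0 ik iJ mJ.
rewrite big_imset /=; last by move=> ? ? _ _; apply: f_inj.
under eq_bigr => x _ do rewrite fE add_lfunE -scaler_nat scale_lfunE.
rewrite big_split /= sumr_const card_ord -scaler_suml -natr_sum => tr0.
have sum_ord : ((\sum_(x < n.+1) x) * 2 = n * n.+1)%N.
  elim: (n) => [|r IHr]; first by rewrite big_ord_recr big_ord0.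
  by rewrite big_ord_recr /= mulnDl IHr (mulnC r) -mulnDr addn2.
(* The trace on the string is [n.+1] times [c' t] plus [0 + 1 + .. + n] times [a t]; the factor
   [n.+1] is cancelled. *)
have c't : 2 * (c' t : K) = - (n%:R * a t).
  apply/eqP; rewrite -subr_eq0 opprK; apply/eqP.
  have n_neq0 : n.+1%:R != 0 :> K by rewrite pnatr_eq0.
  apply: (mulfI n_neq0); rewrite mulr0.
  have := congr1 (fun z : K => 2 * z) tr0; rewrite mulr0 => <-.
  rewrite mulrDr mulrDr; congr (_ + _).
    exact: etrans (mulr_natl _ _) (esym (mulrnAr _ _ _)).
  rewrite -[X in _ = _ * X]/(_ * _) !mulrA -!natrM; congr (_%:R * _).
  by rewrite mulnC -sum_ord mulnC.
have at_neq0 : a t != 0 :> K by rewrite -formE.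
have coefE : 2 * dual_form c a / dual_form a a = q%:R - p%:R.
  apply: (mulIf aa_neq0); rewrite divfK // !formE -/t.
  have -> : c = c' + a *+ q by rewrite subrK.
  rewrite add_lfunE mulrDr c't -(scaler_nat _ a) scale_lfunE -[_ *: _]/(_ * _) /n natrD.
  by ring.
(* The reflection reverses the string: the member number [q] goes to the member number [p]. *)
have -> : reflection a c = c' + a *+ p.
  rewrite /reflection coefE scalerBl !scaler_nat opprB addrA addrAC.
  by rewrite /c' addrAC.
by apply: string; rewrite leq_addl.
Qed.

End RootReflections.

(** * Simple roots and products of orthogonal reflections *)

Section SimpleRootSystem.
Variables (K : numFieldType) (g : lieAlgebraType K) (g_simple : lie_simple g).
Variables (h : {vspace g}) (h_cartan : cartan_subalgebra h).
Variables (P : seq (dual h)) (P_simple : simple_roots P).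
Implicit Types (a b c : dual h) (Q : seq (dual h)).

(** Lets the following facts on roots be stated without reference to a weight basis. *)
Lemma exists_nondegenerate_weight_basis :
  exists (B : (\dim {:g}).-tuple g) (w : 'I_(\dim {:g}) -> dual h),
    [/\ basis_of {:g} B, forall j, root_vector (w j) B`_j
      & forall x : g, (forall y, killing x y = 0) -> x = 0].
Proof.
have [B [w [B_basis B_root]]] := exists_weight_basis h_cartan.
exists B, w; split=> //.
exact: (killing_nondegenerate g_simple h_cartan B_basis B_root P_simple).
Qed.

Lemma oppr_root a : is_root a -> is_root (- a).
Proof.
have [B [w [B_basis B_root nondeg]]] := exists_nondegenerate_weight_basis.
exact: (root_opp h_cartan B_basis B_root nondeg).
Qed.

Lemma refl_root a c : is_root a -> is_root c -> is_root (reflection a c).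
Proof.
have [B [w [B_basis B_root nondeg]]] := exists_nondegenerate_weight_basis.
exact: (reflection_root h_cartan B_basis B_root nondeg).
Qed.

Lemma root_multiple a m : is_root a -> is_root (a *+ m) -> m = 1%N.
Proof.
have [B [w [B_basis B_root nondeg]]] := exists_nondegenerate_weight_basis.
exact: (root_mulrn h_cartan B_basis B_root nondeg).
Qed.

Lemma root_form_neq0 a : is_root a -> dual_form a a != 0.
Proof.
have [B [w [B_basis B_root nondeg]]] := exists_nondegenerate_weight_basis.
exact: (dual_form_root_neq0 h_cartan B_basis B_root nondeg).
Qed.

Lemma dual_form_is_scalar b : scalar (fun a => dual_form a b).
Proof.
have [B [w [B_basis B_root nondeg]]] := exists_nondegenerate_weight_basis.
exact: (dual_form_linear h_cartan B_basis B_root nondeg).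
Qed.

Lemma dual_formDl a b c : dual_form (a + b) c = dual_form a c + dual_form b c.
Proof. by have := dual_form_is_scalar c 1 a b; rewrite scale1r mul1r. Qed.

Lemma dual_form0l b : dual_form (0 : dual h) b = 0.
Proof.
by apply/eqP; rewrite -(inj_eq (addrI (dual_form 0 b))) -dual_formDl !addr0.
Qed.

Lemma dual_formZl k a b : dual_form (k *: a) b = k * dual_form a b.
Proof. by have := dual_form_is_scalar b k a 0; rewrite dual_form0l !addr0. Qed.

Lemma dual_formNl a b : dual_form (- a) b = - dual_form a b.
Proof. by rewrite -scaleN1r dual_formZl mulN1r. Qed.

Lemma dual_form_suml (I : Type) (r : seq I) (F : I -> dual h) b :
  dual_form (\sum_(i <- r) F i) b = \sum_(i <- r) dual_form (F i) b.
Proof.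
exact: (big_morph (fun a => dual_form a b) (fun a c => dual_formDl a c b)
  (dual_form0l b)).
Qed.

Lemma dual_formNr a b : dual_form b (- a) = - dual_form b a.
Proof. by rewrite dual_formC dual_formNl dual_formC. Qed.

Lemma reflection_isometry a b c : is_root a ->
  dual_form (reflection a b) (reflection a c) = dual_form b c.
Proof.
move=> /root_form_neq0 aa_neq0; rewrite /reflection.
rewrite dual_formDl dual_formNl dual_formZl !(dual_formC _ (_ - _)).
rewrite !dual_formDl !dual_formNl !dual_formZl.
rewrite (dual_formC c b) (dual_formC c a) (dual_formC b a).
by field.
Qed.

(** By orthogonality, reflecting in the other members of [Q] does not change the pairing with
    [b]. *)
Lemma reflectionsE Q a : uniq Q -> mutually_orthogonal [set` Q] ->
  reflections Q a =
    a - \sum_(b <- Q) (2 * dual_form a b / dual_form b b) *: b.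
Proof.
elim: Q => [|b Q IHQ] /=; first by rewrite big_nil subr0.
move=> /andP[bQ uQ] orthQ; have {}IHQ := IHQ uQ.
rewrite big_cons IHQ; last first.
  by move=> c d cQ dQ; apply: orthQ; rewrite /= inE ?cQ ?dQ orbT.
rewrite /reflection opprD addrA addrAC; congr (_ - _ - _); congr (_ *: _).
congr (_ * _ / _).
rewrite dual_formDl dual_formNl dual_form_suml big_seq big1 ?subr0 // => c cQ.
rewrite dual_formZl (orthQ c b) ?mulr0 //=; [by rewrite inE cQ orbT|by rewrite inE eqxx|].
by apply: contraNneq bQ => <-.
Qed.

Lemma reflections_root Q a : {in Q, forall b, is_root b} ->
  is_root a -> is_root (reflections Q a).
Proof.
elim: Q => [|b Q IHQ] //= rQ ra; apply: refl_root; first by apply: rQ; rewrite inE eqxx.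
by apply: IHQ => // c cQ; apply: rQ; rewrite inE cQ orbT.
Qed.

Lemma reflections_isometry Q a b : {in Q, forall c, is_root c} ->
  dual_form (reflections Q a) (reflections Q b) = dual_form a b.
Proof.
elim: Q => [|c Q IHQ] //= rQ; rewrite reflection_isometry; last first.
  by apply: rQ; rewrite inE eqxx.
by apply: IHQ => // d dQ; apply: rQ; rewrite inE dQ orbT.
Qed.

Lemma reflectionsN Q a : uniq Q -> mutually_orthogonal [set` Q] ->
  reflections Q (- a) = - reflections Q a.
Proof.
move=> uQ oQ; rewrite !reflectionsE // opprB addrC; congr (_ + _).
rewrite -sumrN; apply: eq_bigr => b _.
by rewrite dual_formNl mulrN mulNr scaleNr opprK.
Qed.

Lemma form_reflections Q a b : {in Q, forall c, is_root c} -> uniq Q ->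
  mutually_orthogonal [set` Q] -> b \in Q ->
  dual_form (reflections Q a) b = - dual_form a b.
Proof.
move=> rQ uQ oQ bQ; rewrite reflectionsE // dual_formDl dual_formNl dual_form_suml.
rewrite (bigD1_seq b) //= big_seq_cond big1 => [|c /andP[cQ ne_cb]]; last first.
  by rewrite dual_formZl (oQ c b cQ bQ ne_cb) mulr0.
rewrite dual_formZl addr0; have bb_neq0 := root_form_neq0 (rQ b bQ).
by field.
Qed.

(** Applying the product changes the sign of every pairing with a member of [Q], so the second
    correction cancels the first. *)
Lemma reflectionsK Q : {in Q, forall c, is_root c} -> uniq Q ->
  mutually_orthogonal [set` Q] -> involutive (reflections Q).
Proof.
move=> rQ uQ oQ a; rewrite reflectionsE //.
rewrite (eq_big_seq (fun b => - ((2 * dual_form a b / dual_form b b) *: b))).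
  by rewrite sumrN opprK reflectionsE // subrK.
by move=> b bQ; rewrite form_reflections // mulrN mulNr scaleNr.
Qed.

Lemma reflections_mem Q b : {in Q, forall c, is_root c} -> uniq Q ->
  mutually_orthogonal [set` Q] -> b \in Q -> reflections Q b = - b.
Proof.
move=> rQ uQ oQ bQ; rewrite reflectionsE // (bigD1_seq b) //= big_seq_cond.
rewrite big1 => [|c /andP[cQ ne_cb]]; last first.
  by rewrite dual_formC (oQ c b cQ bQ ne_cb) mulr0 mul0r scale0r.
by rewrite mulfK ?(root_form_neq0 (rQ b bQ)) // addr0 scaler_nat mulr2n opprD addNKr.
Qed.

Lemma simple_uniq : uniq P.
Proof. by have [_ /basis_free/free_uniq] := P_simple. Qed.

Lemma simple_comb_inj (k1 k2 : dual h -> K) :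
  \sum_(b <- P) k1 b *: b = \sum_(b <- P) k2 b *: b -> {in P, k1 =1 k2}.
Proof.
have [_ P_basis _] := P_simple => k12.
have [|k _ k_uniq] := free_span (v := \sum_(b <- P) k1 b *: b) (basis_free P_basis).
  by rewrite (span_basis P_basis) memvf.
by move=> b bP; rewrite (k_uniq k1) // (k_uniq k2).
Qed.

(** The coefficients of a root have a common sign, so one positive coefficient decides it. *)
Lemma root_coef_gt0 a b (k : dual h -> K) : is_root a ->
  a = \sum_(c <- P) k c *: c -> b \in P -> 0 < k b -> nonneg_comb P a.
Proof.
have [_ _ sgnP] := P_simple; move=> /sgnP[//|[n na]] aE bP kb_gt0.
have nk : \sum_(c <- P) (n c)%:R *: c = \sum_(c <- P) (- k c) *: c.
  by under eq_bigr do rewrite scaler_nat; rewrite -na aE -sumrN;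
    apply: eq_bigr => c _; rewrite scaleNr.
have /eqP := simple_comb_inj nk bP; rewrite -addr_eq0 => /eqP nk0.
by have := ltr_wpDl (ler0n K (n b)) kb_gt0; rewrite nk0 ltxx.
Qed.

Lemma nonneg_comb_coef a b (k : dual h -> K) : nonneg_comb P a ->
  a = \sum_(c <- P) k c *: c -> b \in P -> 0 <= k b.
Proof.
move=> [n na] aE bP.
have nk : \sum_(c <- P) (n c)%:R *: c = \sum_(c <- P) k c *: c.
  by under eq_bigr do rewrite scaler_nat; rewrite -na aE.
by rewrite -(simple_comb_inj nk bP) ler0n.
Qed.

Lemma nonneg_comb_opp a : nonneg_comb P a -> nonneg_comb P (- a) -> a = 0.
Proof.
move=> [n na] a_neg.
have aE : - a = \sum_(c <- P) (- (n c)%:R) *: c.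
  by rewrite na -sumrN; apply: eq_bigr => c _; rewrite scaleNr scaler_nat.
rewrite na big_seq big1 // => b bP; have := nonneg_comb_coef a_neg aE bP.
by rewrite oppr_ge0 lern0 => /eqP ->; rewrite mulr0n.
Qed.

Lemma nonneg_comb_simple b : b \in P -> nonneg_comb P b.
Proof.
move=> bP; exists (fun c => (c == b) : nat).
rewrite (bigD1_seq b) ?simple_uniq //= eqxx big1 ?addr0 // => c /negPf ->.
by rewrite mulr0n.
Qed.

Section OrthogonalSimpleRoots.
Variables (Q : seq (dual h)).
Hypotheses (Q_uniq : uniq Q) (QP : {subset Q <= P})
  (Q_orth : mutually_orthogonal [set` Q]).

(** Choose [b] in [Q] with [n b] nonzero. By orthogonality, [reflection b a] has coefficient [- n b]
    at [b] and the coefficients of [a] elsewhere. As a root has coefficients of one sign, the others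
    vanish, and the multiple [b *+ n b] is a root only if [n b] is 1. *)
Lemma root_in_orthogonal_cone (n : dual h -> nat) a : is_root a ->
  a = \sum_(b <- P) b *+ n b -> {in P, forall b, b \notin Q -> n b = 0%N} ->
  a \in Q.
Proof.
move=> ra aE n0; have [rP _ sgnP] := P_simple; have [a_neq0 _] := ra.
have [b bP nb] : exists2 b, b \in P & n b != 0%N.
  apply: contrapT => no_b; case/eqP: a_neq0; rewrite aE big_seq big1 // => b bP.
  have [->|nb] := eqVneq (n b) 0%N; first by rewrite mulr0n.
  by case: no_b; exists b.
have bQ : b \in Q by apply: contraNT nb => /(n0 b bP) ->.
have rb := rP b bP; have bb_neq0 := root_form_neq0 rb.
have ab : dual_form a b = (n b)%:R * dual_form b b.
  rewrite aE dual_form_suml (bigD1_seq b) ?simple_uniq //= big_seq_cond big1 => [|c].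
    by rewrite addr0 -scaler_nat dual_formZl.
  case/andP=> cP ne_cb; rewrite -scaler_nat dual_formZl.
  have [cQ|/(n0 c cP) ->] := boolP (c \in Q); last by rewrite mul0r.
  by rewrite (Q_orth cQ bQ ne_cb) mulr0.
pose k c : K := (n c)%:R - (if c == b then 2 * (n b)%:R else 0).
have raE : reflection b a = \sum_(c <- P) k c *: c.
  under eq_bigr do rewrite scalerBl scaler_nat; rewrite sumrB -aE.
  rewrite (bigD1_seq b) ?simple_uniq //= eqxx big1 ?addr0 => [|c /negPf ->].
    by rewrite /reflection ab mulrA mulfK.
  by rewrite scale0r.
have nb_gt0 : 0 < (n b)%:R :> K by rewrite ltr0n lt0n.
have kb_lt0 : k b < 0.
  by rewrite /k eqxx mulr_natl mulr2n opprD addNKr oppr_lt0.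
have ref_neg : nonneg_comb P (- reflection b a).
  have [ref_pos|//] := sgnP _ (refl_root rb ra).
  by have := nonneg_comb_coef ref_pos raE bP; rewrite (lt_geF kb_lt0).
have nc c : c \in P -> c != b -> n c = 0%N.
  move=> cP ne_cb.
  have := @nonneg_comb_coef _ c (fun d => - k d) ref_neg _ cP.
  rewrite /k (negPf ne_cb) subr0 oppr_ge0 lern0 => nc0; apply/eqP/nc0.
  by rewrite raE -sumrN; apply: eq_bigr => d _; rewrite scaleNr.
have aE' : a = b *+ n b.
  rewrite aE (bigD1_seq b) ?simple_uniq //= big_seq_cond big1 ?addr0 // => c.
  by case/andP=> cP ne_cb; rewrite nc ?mulr0n.
have nb1 : n b = 1%N by apply: (root_multiple rb); rewrite -aE'.
by rewrite aE' nb1 mulr1n.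
Qed.

(** By [root_in_orthogonal_cone], [a] has a positive coefficient at some simple root outside [Q];
    the reflections in [Q] leave it unchanged. *)
Lemma reflections_nonneg a : is_root a -> nonneg_comb P a -> a \notin Q ->
  nonneg_comb P (reflections Q a).
Proof.
move=> ra [n aE] aQ; have [rP _ _] := P_simple.
have [b bP [bQ nb]] : exists2 b, b \in P & b \notin Q /\ n b != 0%N.
  apply: contrapT => no_b; case/negP: aQ; apply: (root_in_orthogonal_cone ra aE).
  move=> b bP bQ; apply/eqP; apply: contrapT => nb; apply: no_b; exists b => //.
  by split=> //; apply/negP.
have rQ : {in Q, forall c, is_root c} by move=> c /QP/rP.
pose k c : K := (n c)%:R - (if c \in Q then 2 * dual_form a c / dual_form c c else 0).
apply: (root_coef_gt0 (b := b) (k := k)) => //; first exact: reflections_root.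
  under eq_bigr do rewrite scalerBl scaler_nat; rewrite sumrB -aE reflectionsE //.
  congr (_ - _); rewrite [RHS](bigID (mem Q)) /= [X in _ = _ + X]big1 => [|c /negPf->].
    rewrite addr0 -[RHS]big_filter [RHS](perm_big Q) /=.
      by rewrite !big_seq; apply: eq_bigr => c ->.
    apply: uniq_perm => //; first by rewrite filter_uniq ?simple_uniq.
    by move=> c; rewrite mem_filter /= andb_idr // => /QP.
  by rewrite scale0r.
by rewrite /k (negPf bQ) subr0 ltr0n lt0n.
Qed.

End OrthogonalSimpleRoots.
End SimpleRootSystem.

(** * Roots on the singular directions *)

Section Sectors.
Variables (K : numFieldType) (g : lieAlgebraType K) (g_simple : lie_simple g).
Variables (h : {vspace g}) (h_cartan : cartan_subalgebra h).
Variables (P1 P2 : seq (dual h)) (P_simple : simple_roots (P1 ++ P2)).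
Hypotheses (P1_orth : mutually_orthogonal [set` P1])
  (P2_orth : mutually_orthogonal [set` P2]).
Let gamma := reflections P2 \o reflections P1.
(** These hypotheses are all that the argument takes from the geometry of the directions. Indexing
    by all naturals, with period [2 * s], lets shifts be written without reduction. *)
Variables (s : nat) (S : nat -> set (dual h)).
Hypotheses (s_gt2 : (2 < s)%N)
  (S_root : forall n b, S n b -> is_root b)
  (S_cover : forall b, is_root b -> exists2 n, (n < 2 * s)%N & S n b)
  (S_inj : forall m n b, (m < 2 * s)%N -> (n < 2 * s)%N -> S m b -> S n b -> m = n)
  (S_period : forall n b, S (n + 2 * s)%N b <-> S n b)
  (S_pos : forall n b, (n < 2 * s)%N -> S n b ->
     nonneg_comb (P1 ++ P2) b <-> (n < s)%N)
  (S_gamma : forall n b, S n b -> S (n + 2)%N (gamma b))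
  (S_opp : forall n b, S n b -> S (n + s)%N (- b))
  (S_extreme : forall m (n : dual h -> nat), m = 0%N \/ m = s.-1 ->
     S m (\sum_(b <- P1 ++ P2) b *+ n b) ->
     {in P1 ++ P2, forall b, n b != 0%N -> S m b}).

Let roots_P : {in P1 ++ P2, forall b, is_root b}.
Proof. by have [] := P_simple. Qed.

Let sub1 : {subset P1 <= P1 ++ P2}.
Proof. by move=> b bP; rewrite mem_cat bP. Qed.

Let sub2 : {subset P2 <= P1 ++ P2}.
Proof. by move=> b bP; rewrite mem_cat bP orbT. Qed.

Let roots_P1 : {in P1, forall b, is_root b}.
Proof. by move=> b /sub1/roots_P. Qed.

Let roots_P2 : {in P2, forall b, is_root b}.
Proof. by move=> b /sub2/roots_P. Qed.

Let uniq_P : [/\ uniq P1, uniq P2 & forall b, b \in P1 -> b \notin P2].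
Proof.
have := simple_uniq P_simple; rewrite cat_uniq => /and3P[u1 /hasPn disj u2].
by split=> // b bP1; apply/negP => /disj; rewrite /= bP1.
Qed.

Let u1 : uniq P1. Proof. by case: uniq_P. Qed.
Let u2 : uniq P2. Proof. by case: uniq_P. Qed.
Let notP2 b : b \in P1 -> b \notin P2. Proof. by case: uniq_P => _ _; apply. Qed.
Let notP1 b : b \in P2 -> b \notin P1. Proof. exact: contraL (@notP2 b). Qed.

Let tau1K := reflectionsK g_simple h_cartan P_simple roots_P1 u1 P1_orth.
Let tau2K := reflectionsK g_simple h_cartan P_simple roots_P2 u2 P2_orth.
Let tau1_mem b := @reflections_mem _ _ g_simple _ h_cartan _ P_simple _ b roots_P1 u1 P1_orth.
Let tau2_mem b := @reflections_mem _ _ g_simple _ h_cartan _ P_simple _ b roots_P2 u2 P2_orth.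
Let tau1N b := @reflectionsN _ _ g_simple _ h_cartan _ P_simple _ b u1 P1_orth.
Let tau2N b := @reflectionsN _ _ g_simple _ h_cartan _ P_simple _ b u2 P2_orth.

Let gammaK b : gamma (reflections P1 (reflections P2 b)) = b.
Proof. by rewrite /gamma /= tau1K tau2K. Qed.

Let gamma_inv_root b : is_root b -> is_root (reflections P1 (reflections P2 b)).
Proof.
by move=> rb; do 2!apply: (reflections_root g_simple h_cartan P_simple) => //.
Qed.

Let tau1_pos b : b \in P2 -> nonneg_comb (P1 ++ P2) (reflections P1 b).
Proof.
move=> bP; apply: (reflections_nonneg g_simple h_cartan P_simple u1 sub1 P1_orth).
- exact: roots_P2.
- exact/(nonneg_comb_simple P_simple)/sub2.
- exact: notP1.
Qed.

Let tau2_pos b : b \in P1 -> nonneg_comb (P1 ++ P2) (reflections P2 b).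
Proof.
move=> bP; apply: (reflections_nonneg g_simple h_cartan P_simple u2 sub2 P2_orth).
- exact: roots_P1.
- exact/(nonneg_comb_simple P_simple)/sub1.
- exact: notP2.
Qed.

Let not_opp b : is_root b -> nonneg_comb (P1 ++ P2) b ->
  nonneg_comb (P1 ++ P2) (- b) -> False.
Proof. by move=> [/eqP b_neq0 _] bpos bneg; apply/b_neq0/(nonneg_comb_opp P_simple). Qed.

Lemma sector_mod n b : S n b <-> S (n %% (2 * s))%N b.
Proof.
rewrite {1}(divn_eq n (2 * s)); elim: (n %/ _)%N => [|k IHk].
  by rewrite mul0n add0n.
by rewrite mulSn -addnA addnC; apply: iff_trans (S_period _ _) _.
Qed.

Lemma sector_inj m n b : S m b -> S n b -> m = n %[mod 2 * s].
Proof.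
move=> /sector_mod Sm /sector_mod Sn; apply: S_inj Sm Sn;
  by rewrite ltn_mod muln_gt0 /=; apply: leq_trans s_gt2.
Qed.

(** The root [b] lies in some [S m], so [gamma b] lies in [S (m + 2)] as well as in [S (n + 2)], and
    [m] and [n] agree modulo [2 * s]. *)
Lemma sector_gammaE n b : is_root b -> S (n + 2)%N (gamma b) -> S n b.
Proof.
move=> /S_cover[m m_lt Sm] Sn; have := sector_inj (S_gamma Sm) Sn.
move/eqP; rewrite eqn_modDr => /eqP mn.
by apply: (sector_mod n b).2; rewrite -mn; apply: (sector_mod m b).1.
Qed.

Lemma sector_iter_gamma n k : S (n + 2 * k)%N = iter k gamma @` S n.
Proof.
elim: k => [|k IHk]; first by rewrite muln0 addn0 image_id.
rewrite mulnS addnCA addnC; apply/seteqP; split=> [b Sb|_ [b Sb <-]] /=.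
  have : S (n + 2 * k)%N (reflections P1 (reflections P2 b)).
    by apply: sector_gammaE; [exact/gamma_inv_root/(S_root Sb)|rewrite gammaK].
  rewrite IHk => -[c Sc cE]; exists c => //.
  by rewrite /= cE gammaK.
by rewrite /=; apply: S_gamma; rewrite IHk; exists b.
Qed.

Let le2s n : (n < s)%N -> (n < 2 * s)%N.
Proof. by move=> n_s; apply: leq_trans n_s _; rewrite leq_pmull. Qed.

Let S_neq m n b : (m < s)%N -> (n < s)%N -> S m b -> S n b -> m = n.
Proof. by move=> /le2s ms /le2s ns; apply: S_inj. Qed.

Let S_lt n b : (n < s)%N -> S n b -> nonneg_comb (P1 ++ P2) b.
Proof. by move=> n_s Sn; apply/(S_pos (le2s n_s) Sn). Qed.

Let pos_sector b : is_root b -> nonneg_comb (P1 ++ P2) b ->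
  exists2 n, (n < s)%N & S n b.
Proof. by move=> /S_cover[n n_lt Sn] /(S_pos n_lt Sn); exists n. Qed.

Lemma P2_sector b : b \in P2 -> S 0%N b \/ S 1%N b.
Proof.
move=> bP; have rb := roots_P2 bP.
have [n n_s Sn] := pos_sector rb (nonneg_comb_simple P_simple (sub2 bP)).
case: n n_s Sn => [|[|n]] n_s Sn; [by left|by right|exfalso].
have rc := gamma_inv_root rb.
(* From an index at least 2, [gamma^-1 b] would still lie in a positive sector, although it equals
   [- tau_1 b]. *)
have Sc : S n (reflections P1 (reflections P2 b)).
  by apply: sector_gammaE => //; rewrite gammaK addn2.
apply: (not_opp rc (S_lt (ltnW (ltnW n_s)) Sc)).
by rewrite tau2_mem // tau1N opprK; apply: tau1_pos.
Qed.

(** If [n + 2 < s] for the index [n] of [b], then [gamma b = - tau_2 b] would lie in a positive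
    sector and be negative. *)
Lemma P1_sector b : b \in P1 -> S s.-2 b \/ S s.-1 b.
Proof.
move=> bP; have rb := roots_P1 bP.
have [n n_s Sn] := pos_sector rb (nonneg_comb_simple P_simple (sub1 bP)).
have [n2|] := ltnP (n + 2) s.
  exfalso; have Sc := S_gamma Sn; apply: (not_opp (S_root Sc) (S_lt n2 Sc)).
  by rewrite /gamma /= tau1_mem // tau2N opprK; apply: tau2_pos.
move=> s_n; have [n_eq|n_eq] : n = s.-2 \/ n = s.-1 by lia.
  by left; rewrite -n_eq.
by right; rewrite -n_eq.
Qed.

Lemma first_sector_sub b : S 0%N b -> b \in P2.
Proof.
move=> S0; have rb := S_root S0.
have [n bE] := S_lt (leq_ltn_trans (leq0n 2) s_gt2) S0.
apply: (root_in_orthogonal_cone g_simple h_cartan P_simple P2_orth rb bE).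
move=> c cP cP2; apply/eqP; apply: contrapT => /negP nc.
have S0c : S 0%N c by apply: S_extreme nc => //; [left|rewrite -bE].
(* Here [2 < s] matters: it separates the index 0 from [s.-2] and [s.-1]. *)
move: cP; rewrite mem_cat (negPf cP2) orbF => /P1_sector.
by case=> Sc; have := S_neq _ _ Sc S0c; lia.
Qed.

Lemma last_sector_sub b : S s.-1 b -> b \in P1.
Proof.
have s1 : (s.-1 < s)%N by rewrite prednK // (leq_ltn_trans _ s_gt2).
move=> S1; have rb := S_root S1; have [n bE] := S_lt s1 S1.
apply: (root_in_orthogonal_cone g_simple h_cartan P_simple P1_orth rb bE).
move=> c cP cP1; apply/eqP; apply: contrapT => /negP nc.
have S1c : S s.-1 c by apply: S_extreme nc => //; [right|rewrite -bE].
move: cP; rewrite mem_cat (negPf cP1) /= => /P2_sector.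
by case=> Sc; have := S_neq _ _ Sc S1c; lia.
Qed.

Lemma first_sector : S 0%N = [set` P2].
Proof.
apply/seteqP; split=> b; first exact: first_sector_sub.
move=> bP; have [//|S1b] := P2_sector bP; exfalso; have rb := roots_P2 bP.
have Sc : S s.-1 (reflections P1 b).
  apply: sector_gammaE; first exact: (reflections_root g_simple h_cartan P_simple).
  have -> : gamma (reflections P1 b) = - b by rewrite /gamma /= tau1K tau2_mem.
  by rewrite addn2 prednK ?(ltnW (ltnW s_gt2)) //; apply: (S_opp S1b).
have cP := last_sector_sub Sc.
apply: (not_opp (roots_P1 cP)); first exact/(nonneg_comb_simple P_simple)/sub1.
by rewrite -tau1_mem // tau1K; apply/(nonneg_comb_simple P_simple)/sub2.
Qed.

Lemma last_sector : S s.-1 = [set` P1].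
Proof.
apply/seteqP; split=> b; first exact: last_sector_sub.
move=> bP; have [S1b|//] := P1_sector bP; exfalso; have rb := roots_P1 bP.
(* [tau_2 b = gamma (- b)] has index [s.-2 + s + 2], which is a full turn, hence index 0. *)
have cP : reflections P2 b \in P2.
  apply: first_sector_sub; apply/S_period.
  have -> : reflections P2 b = gamma (- b).
    by rewrite /gamma /= tau1N tau1_mem // opprK.
  have -> : (0 + 2 * s = s.-2 + s + 2)%N by lia.
  by apply: S_gamma; apply: S_opp.
apply: (not_opp (roots_P2 cP)); first exact/(nonneg_comb_simple P_simple)/sub2.
by rewrite -tau2_mem // tau2K; apply/(nonneg_comb_simple P_simple)/sub1.
Qed.

Lemma opposite_last_sector : S (2 * s).-1 = [set - b | b in [set` P1]].
Proof.
have sE : ((2 * s).-1 = s.-1 + s)%N by lia.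
rewrite sE; apply/seteqP; split=> [b /S_opp Sb|_ [b bP <-]].
  exists (- b); last exact: opprK.
  by rewrite -last_sector; apply/S_period; rewrite mul2n -addnn addnA.
by apply: S_opp; rewrite last_sector.
Qed.

(** Modulo the period, [(2 * s).-1] stands for the index -1, so the odd indices [2 * k - 1] are
    reached from [k = 0] without a subtraction. *)
Lemma sectorsE k :
  S (2 * k) = iter k gamma @` [set` P2] /\
  S ((2 * s).-1 + 2 * k) = iter k gamma @` [set - b | b in [set` P1]].
Proof.
by rewrite -first_sector -opposite_last_sector -!sector_iter_gamma.
Qed.

End Sectors.

(** * Angles *)

Section ComplexExponential.
Variable R : realType.
Local Notation C := R[i].
Implicit Types (x y : R).

Lemma cvg_complex (u : nat -> C) (a b : R) :
  (fun n => complex.Re (u n)) @ \oo --> a -> (fun n => complex.Im (u n)) @ \oo --> b ->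
  (u : nat -> C^o) @ \oo --> ((a +i* b)%C : C^o).
Proof.
move=> ua ub; apply/(@cvgrPdist_lt C C^o) => -[e im_e].
rewrite ltcE /= => /andP[/eqP -> e_gt0].
have e2_gt0 : 0 < e / 2 by rewrite divr_gt0.
have /cvgrPdist_lt/(_ _ e2_gt0) ua_e := ua.
have /cvgrPdist_lt/(_ _ e2_gt0) ub_e := ub.
near=> n.
have an : `|a - complex.Re (u n)| < e / 2 by near: n.
have bn : `|b - complex.Im (u n)| < e / 2 by near: n.
rewrite [X in `|X|]complexE; apply: le_lt_trans (ler_normD _ _) _.
have normC x : `|x%:C%C : C| = `|x|%:C%C.
  by rewrite normc_def /= expr0n addr0 sqrtr_sqr.
have normi : `|'i%C : C| = 1 by rewrite normc_def /= expr0n expr1n add0r sqrtr1.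
have -> : complex.Re ((a +i* b)%C - u n) = a - complex.Re (u n) by case: (u n).
have -> : complex.Im ((a +i* b)%C - u n) = b - complex.Im (u n) by case: (u n).
rewrite normrM normi mul1r !normC -rmorphD ltcR /=.
(* The modulus is at most the sum of the two coordinate errors, each below half of [e]. *)
by rewrite (splitr e) ltrD.
Unshelve. all: by end_near. Qed.

(** Written in the shape of [cos_coeff] and [sin_coeff], up to the factorial; for [k = 0] the
    truncated [k.-1] is harmless, being multiplied by zero. *)
Lemma imaginary_exprn y k : (0 +i* y)%C ^+ k =
  (((~~ odd k)%:R * (-1) ^+ k./2 * y ^+ k) +i*
   ((odd k)%:R * (-1) ^+ k.-1./2 * y ^+ k))%C.
Proof.
have sqr_iy : (0 +i* y)%C ^+ 2 = (- y ^+ 2)%:C%C.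
  by rewrite expr2; simpc; rewrite expr2.
have even_iy m : (0 +i* y)%C ^+ m.*2 = ((-1) ^+ m * y ^+ m.*2)%:C%C.
  by rewrite -!mul2n exprM sqr_iy -rmorphXn /= (exprNn (y ^+ 2)) -exprM.
rewrite -(odd_double_half k); case: (odd k); last first.
  by rewrite add0n odd_double /= even_iy doubleK mul1r !mul0r.
rewrite add1n exprS even_iy /= odd_double /= doubleK mul1r !mul0r; simpc.
by congr (_ +i* _)%C; rewrite exprS; ring.
Qed.

(** Under a linear form, the partial sums of the exponential series at [v] become those of the
    cosine and sine series times a constant. Limits are unique, and the coordinate forms separate
    vectors. *)
Lemma is_exp_imaginary_eigenvector (g : vectType C) (D E : 'End(g)) v y :
  is_exp D E -> D v = (0 +i* y)%C *: v -> E v = cis y *: v.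
Proof.
move=> DE Dv; apply/eqP; rewrite -subr_eq0; apply/eqP.
have iterD k : iter k D v = (0 +i* y)%C ^+ k *: v.
  elim: k => [|k IHk]; first by rewrite scale1r.
  by rewrite iterS IHk linearZ /= Dv scalerA -exprSr.
pose u n : C := \sum_(0 <= k < n) (cos_coeff y k +i* sin_coeff y k)%C.
have u_cis : (u : nat -> C^o) @ \oo --> (cis y : C^o).
  have ReD n : @complex.Re R (u n) = series (cos_coeff y) n.
    by rewrite /u (big_morph (@complex.Re R) (id1 := 0) (op1 := +%R)) // => -[? ?] [].
  have ImD n : complex.Im (u n) = series (sin_coeff y) n.
    by rewrite /u (big_morph (@complex.Im R) (id1 := 0) (op1 := +%R)) // => -[? ?] [].
  apply: cvg_complex; [under eq_fun do rewrite ReD|under eq_fun do rewrite ImD].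
    by rewrite unlock; apply: is_cvg_series_cos_coeff.
  by rewrite unlock; apply: is_cvg_series_sin_coeff.
have phi_eq (phi : 'Hom(g, C^o)) : phi (E v) = cis y * phi v.
  have phiE n : phi (\sum_(0 <= k < n) (k`!%:R : C)^-1 *: iter k D v) = u n * phi v.
    rewrite linear_sum /u mulr_suml; apply: eq_bigr => k _.
    rewrite iterD scalerA linearZ /=; congr (_ * _).
    rewrite imaginary_exprn /cos_coeff /sin_coeff /=.
    have -> : (k`!%:R : C)^-1 = (k`!%:R^-1)%:C%C by rewrite fmorphV rmorph_nat.
    by simpc; rewrite mulrC (mulrC (k`!%:R^-1)).
  have := DE v phi; under eq_fun do rewrite phiE.
  move=> phi_lim; apply: (cvg_unique _ phi_lim); first exact: norm_hausdorff.
  exact: (@cvgMr_tmp C _ _ _ u (cis y) (phi v) u_cis).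
rewrite (coord_vbasis (memvf (E v - cis y *: v))) big1 // => j _.
pose phi : 'Hom(g, C^o) := linfun (coord (vbasis {:g}) j : g -> C^o).
have phiE : phi =1 coord (vbasis {:g}) j.
  by apply: linear_lfunE => a x1 x2; rewrite linearP.
by rewrite linearB linearZ /= -!phiE phi_eq subrr scale0r.
Qed.

End ComplexExponential.

Section Angles.
Variable R : realType.
Local Notation C := R[i].
Implicit Types (x y r t : R).

(** Translation by [del] induces a strictly increasing map [f] on indices, whose image contains
    every index from [f 0] on; such a map adds [f 0]. *)
Lemma increasing_shift (T : nat -> R) (del : R) :
    (forall n, T n < T n.+1) -> (forall n, exists m, T m = T n + del) ->
    (forall n, T 0%N + del <= T n -> exists m, T m + del = T n) ->
  exists k, forall n, T (n + k)%N = T n + del.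
Proof.
move=> T_incr T_up T_down.
have T_mono : {mono T : m n / (m <= n)%N >-> m <= n} by exact/increasing_seqP.
have T_lt : {mono T : m n / (m < n)%N >-> m < n}.
  by move=> m n; rewrite !ltNge T_mono ltnNge.
have T_inj : injective T.
  by move=> m n Tmn; apply/eqP; rewrite eqn_leq -!T_mono Tmn lexx.
have /boolp.choice[f fE] := T_up.
have f_lt m n : (f m < f n)%N = (m < n)%N by rewrite -T_lt !fE ltrD2r T_lt.
have f_le m n : (f m <= f n)%N = (m <= n)%N by rewrite leqNgt f_lt -leqNgt.
exists (f 0%N) => n; rewrite -fE; congr T.
elim: n => [//|n IHn]; rewrite addSn IHn; apply/eqP; rewrite eqn_leq f_lt ltnSn /=.
have [m mE] : exists m, T m + del = T (f n).+1.
  by apply: T_down; rewrite -fE T_mono; apply: leqW; rewrite f_le.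
have fm : f m = (f n).+1 by apply: T_inj; rewrite fE.
by rewrite -fm f_le -f_lt fm.
Qed.

Lemma cos_eq1 x : `|x| < 2 * pi -> cos x = 1 -> x = 0.
Proof.
move=> x_lt cosx; apply: contrapT => /eqP x_neq0.
have h_gt0 : 0 < `|x| / 2 by rewrite divr_gt0 // normr_gt0.
have h_lt : `|x| / 2 < pi by rewrite ltr_pdivrMr // mulrC.
have : 0 < sin (`|x| / 2) by apply: sin_gt0_pi; rewrite h_gt0.
have : sin (`|x| / 2) ^+ 2 = 0.
  have : cos ((`|x| / 2) *+ 2) = 1 by rewrite -mulr_natr divfK // cos_norm.
  rewrite cos_mulr2n cos2sin2 => cosh; lra.
by move=> /eqP; rewrite sqrf_eq0 => /eqP ->; rewrite ltxx.
Qed.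

Lemma cisD x y : cis (x + y) = cis x * cis y.
Proof. by rewrite /cis cosD sinD; simpc; rewrite (addrC (cos x * sin y)). Qed.

Lemma cisDpi x : cis (x + pi) = - cis x.
Proof. by rewrite /cis cosDpi sinDpi; simpc. Qed.

Lemma cisN_pi x : cis (- (x + pi)) = - cis (- x).
Proof. by have := cisDpi (- x - pi); rewrite subrK => ->; rewrite opprK opprD. Qed.

Lemma cisD2pi x : cis (x + 2 * pi) = cis x.
Proof. by rewrite mulr_natl /cis cosD2pi sinD2pi. Qed.

Lemma cis_neq0 x : cis x != 0.
Proof.
apply/eqP => -[cos0 sin0]; have := cos2Dsin2 x.
by rewrite cos0 sin0 expr0n addr0 => /eqP; rewrite eq_sym oner_eq0.
Qed.

Lemma polar_inj r t x y : 0 < r -> 0 < t ->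
  r%:C%C * cis x = t%:C%C * cis y -> cos (x - y) = 1.
Proof.
move=> r_gt0 t_gt0; rewrite /cis; simpc => -[rt_cos rt_sin].
have x1 := cos2Dsin2 x; have y1 := cos2Dsin2 y.
have rt : r = t.
  apply/eqP; rewrite -(@eqrXn2 _ 2) ?ltW // -[r ^+ 2]mulr1 -[t ^+ 2]mulr1 -{1}x1 -y1.
  by rewrite !mulrDr -!exprMn rt_cos rt_sin.
have r_neq0 : r != 0 by rewrite gt_eqF.
rewrite cosB; move: rt_cos rt_sin; rewrite -rt.
by move=> /(mulfI r_neq0) <- /(mulfI r_neq0) <-; rewrite -!expr2.
Qed.

Section Unwinding.
Variables (N : nat) (theta : nat -> R).
Hypotheses (N_gt0 : (0 < N)%N)
  (theta_incr : forall i j, (1 <= i)%N -> (i < j)%N -> (j <= N)%N ->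
     theta i < theta j)
  (theta_turn : theta N < theta 1%N + 2 * pi).

(* The angles [theta 1, .., theta N] continued periodically and renumbered from
   [0], so that the direction [d i] becomes the number [i.-1]. *)
Definition unwind n := theta (n %% N).+1 + 2 * pi * (n %/ N)%:R.

Lemma unwind_small n : (n < N)%N -> unwind n = theta n.+1.
Proof. by move=> n_N; rewrite /unwind modn_small // divn_small // mulr0 addr0. Qed.

Lemma unwindD n : unwind (n + N) = unwind n + 2 * pi.
Proof.
by rewrite /unwind modnDr divnDr // divnn N_gt0 natrD mulrDr mulr1 addrA.
Qed.

(** Inside a turn this is [theta_incr]; from one turn to the next it is [theta_turn]. *)
Lemma unwind_incr n : unwind n < unwind n.+1.
Proof.
rewrite (divn_eq n N); set q := (n %/ N)%N; have r_N : (n %% N < N)%N by rewrite ltn_mod.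
move: (n %% N)%N r_N => r r_N.
have unwindE k : unwind (q * N + k) = unwind k + 2 * pi * q%:R.
  elim: q => [|p IHp]; first by rewrite mul0n mulr0 addr0.
  by rewrite mulSn -addnA addnC unwindD IHp -[p.+1]addn1 natrD
     (mulrDr (2 * pi)) mulr1 addrA.
rewrite -addnS !unwindE ltrD2r unwind_small //.
have [r1_N|] := ltnP r.+1 N; first by rewrite unwind_small // theta_incr.
rewrite leq_eqVlt => /orP[/eqP N_eq|]; last by rewrite ltnS leqNgt r_N.
have -> : unwind r.+1 = theta 1%N + 2 * pi.
  by rewrite -N_eq -[N in unwind N]add0n unwindD unwind_small.
by rewrite -N_eq.
Qed.

End Unwinding.
End Angles.

(** * The Coxeter element and negation as shifts of the singular directions *)

Section SingularSectors.
Variables (R : realType) (g : lieAlgebraType R[i]) (g_simple : lie_simple g).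
Variables (h : {vspace g}) (h_cartan : cartan_subalgebra h).
Variables (P1 P2 : seq (dual h)) (P_simple : simple_roots (P1 ++ P2)).
Hypotheses (P1_orth : mutually_orthogonal [set` P1])
  (P2_orth : mutually_orthogonal [set` P2]).
Let gamma := reflections P2 \o reflections P1.
Variables (E : g) (s : nat) (d : nat -> set R[i]) (theta : nat -> R).
Local Notation z := (root_value h E).
Hypotheses (s_gt2 : (2 < s)%N)
  (z_gamma : forall b, z (gamma b) = cis (- (2 * pi / s%:R)) * z b)
  (d_all : [set d i | i in [set i | (1 <= i <= 2 * s)%N]] =
     singular_directions h E)
  (d_ray : forall i, (1 <= i <= 2 * s)%N -> d i = ray (cis (- theta i)))
  (theta_incr : forall i j, (1 <= i)%N -> (i < j)%N -> (j <= 2 * s)%N ->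
     theta i < theta j)
  (theta_turn : theta (2 * s)%N < theta 1%N + 2 * pi)
  (d_positive : positive_roots (P1 ++ P2) =
     \bigcup_(i in [set i | (1 <= i <= s)%N]) direction_roots h E (d i)).
Implicit Types (b : dual h) (x : R).

(** Angles are measured clockwise, hence the sign, and are not reduced modulo a full turn. *)
Definition at_angle x b := is_root b /\ exists2 r : R, 0 < r & z b = r%:C%C * cis (- x).

Definition sector n := [set b | at_angle (unwind (2 * s) theta n) b].

Let N_gt0 : (0 < 2 * s)%N. Proof. by rewrite muln_gt0 /=; apply: leq_trans s_gt2. Qed.

Let T := unwind (2 * s) theta.

Let T_small n : (n < 2 * s)%N -> T n = theta n.+1.
Proof. exact: unwind_small. Qed.

Let T_incr n : T n < T n.+1.
Proof. exact: (unwind_incr N_gt0 theta_incr theta_turn). Qed.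

Let TD n : T (n + 2 * s) = T n + 2 * pi.
Proof. exact: unwindD. Qed.

Let z_opp b : z (- b) = - z b. Proof. by rewrite /root_value opp_lfunE. Qed.

Lemma direction_rootsE i : (1 <= i <= 2 * s)%N ->
  direction_roots h E (d i) = sector i.-1.
Proof.
move=> i_s; have i1 : (i.-1 < 2 * s)%N by lia.
rewrite /direction_roots d_ray // /sector /at_angle; apply/seteqP.
by rewrite -/T T_small // prednK; [split|lia].
Qed.

Lemma at_angleD2pi x b : at_angle (x + 2 * pi) b <-> at_angle x b.
Proof.
rewrite /at_angle; have -> // : cis (- (x + 2 * pi)) = cis (- x).
by rewrite -[LHS]cisD2pi; congr cis; ring.
Qed.

Lemma root_at_angle b : is_root b -> exists2 n, (n < 2 * s)%N & at_angle (T n) b.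
Proof.
move=> rb; have : singular_directions h E (ray (z b)) by exists b.
rewrite -d_all => -[i i_s di]; exists i.-1; first by move: i_s => /=; lia.
split=> //; have : ray (z b) (z b) by exists 1; rewrite // mul1r.
rewrite T_small; last by move: i_s => /=; lia.
by rewrite prednK; [rewrite -di d_ray|move: i_s => /=; lia].
Qed.

Lemma sector_nonempty n : exists b, at_angle (T n) b.
Proof.
have : [set d i | i in [set i | (1 <= i <= 2 * s)%N]] (d (n %% (2 * s)).+1).
  by exists (n %% (2 * s)).+1 => //=; rewrite ltn_mod N_gt0.
rewrite d_all => -[b rb]; rewrite d_ray ?ltn_mod //= => bE; exists b.
have : ray (cis (- theta (n %% (2 * s)).+1)) (z b).
  by rewrite -bE; exists 1; rewrite // mul1r.
rewrite -T_small ?ltn_mod // => nb.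
have turns k m : at_angle (T m) b -> at_angle (T (k * (2 * s) + m)) b.
  move=> mb; elim: k => [|k IHk]; first by rewrite mul0n add0n.
  by rewrite mulSn -addnA addnC TD; apply/at_angleD2pi.
by rewrite (divn_eq n (2 * s)); apply: turns.
Qed.

Lemma at_angle_inj x y b : at_angle x b -> at_angle y b -> cos (y - x) = 1.
Proof.
move=> [_ [r r_gt0 zr]] [_ [t t_gt0 zt]].
by have := polar_inj r_gt0 t_gt0 (etrans (esym zr) zt); rewrite opprK addrC.
Qed.

(** Induction on a bound for the number of turns between [T 0] and [x]. Within the first turn, [x]
    and the angle that labels the direction of [b] differ by less than a full turn and have the same
    ray, so they are equal. *)
Lemma at_angle_unwind x b : at_angle x b -> T 0%N <= x -> exists n, T n = x.
Proof.
move=> xb x_ge; pose k := Num.bound (x - T 0%N).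
have x_lt : x < T 0%N + 2 * pi * k%:R.
  rewrite addrC -ltrBlDr; apply: lt_le_trans (archi_boundP _) _; first by rewrite subr_ge0.
  by rewrite ler_peMl //; have := pi_ge2 R; lra.
move: k x_lt => k; elim: k x xb x_ge => [|k IHk] x xb x_ge x_lt.
  by move: x_lt; rewrite mulr0 addr0 ltNge x_ge.
have pi_gt0 := pi_gt0 R.
have [x_small|x_big] := ltP x (T 0%N + 2 * pi).
  have [n n_s nb] := root_at_angle xb.1; exists n.
  have : cos (T n - x) = 1 by apply: at_angle_inj xb nb.
  have T0n : T 0%N <= T n.
    have /increasing_seqP Tm := T_incr; by rewrite Tm.
  have Tn : T n < T 0%N + 2 * pi.
    rewrite -TD; have /increasing_seqP Tm := T_incr; by rewrite ltNge Tm -ltnNge.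
  by move=> /cos_eq1 Tx; apply/eqP; rewrite -subr_eq0; apply/eqP/Tx; rewrite ltr_norml; lra.
have [|||n nE] := IHk (x - 2 * pi).
- by apply/at_angleD2pi; rewrite subrK.
- by lra.
- by move: x_lt; rewrite -[k.+1]addn1 natrD (mulrDr (2 * pi)); lra.
by exists (n + 2 * s)%N; rewrite TD nE subrK.
Qed.

(** As every direction carries a root, [phi] shows that the set of angles [T n] is stable under
    adding [del], and [phi'] that subtracting [del] stays in it as long as the result is at least
    [T 0]. *)
Lemma sector_shift del (phi phi' : dual h -> dual h) :
    (forall x b, at_angle x b -> at_angle (x + del) (phi b)) ->
    (forall x b, at_angle (x + del) b -> at_angle x (phi' b)) ->
    0 < del ->
  exists k, forall n, T (n + k)%N = T n + del.
Proof.
move=> up down del_gt0; apply: (increasing_shift T_incr) => n.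
  have [b nb] := sector_nonempty n.
  apply: (at_angle_unwind (up _ _ nb)).
  have /increasing_seqP Tm := T_incr.
  by apply: le_trans (_ : T n <= _); rewrite ?Tm // lerDl ltW.
move=> n_ge; have [b nb] := sector_nonempty n.
have [||m mE] := at_angle_unwind (x := T n - del) (b := phi' b).
- by apply: down; rewrite subrK.
- by lra.
by exists m; rewrite mE subrK.
Qed.

Let T_inj : injective T.
Proof.
have /increasing_seqP Tm := T_incr.
by move=> m n Tmn; apply/eqP; rewrite eqn_leq -!Tm Tmn lexx.
Qed.

Lemma shift_iter del k m n : (forall n, T (n + k)%N = T n + del) ->
  T (n + m * k) = T n + m%:R * del.
Proof.
move=> shift; elim: m => [|m IHm]; first by rewrite mul0n addn0 mul0r addr0.
by rewrite mulSn addnCA addnC shift IHm -[m.+1]addn1 natrD mulrDl mul1r addrA.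
Qed.

Let rP1 : {in P1, forall b, is_root b}.
Proof. by have [rP _ _] := P_simple; move=> b bP; apply: rP; rewrite mem_cat bP. Qed.

Let rP2 : {in P2, forall b, is_root b}.
Proof. by have [rP _ _] := P_simple; move=> b bP; apply: rP; rewrite mem_cat bP orbT. Qed.

Let uP : uniq P1 /\ uniq P2.
Proof. by have := simple_uniq P_simple; rewrite cat_uniq => /and3P[]. Qed.

Let gamma_root b : is_root b -> is_root (gamma b).
Proof. by move=> rb; do 2!apply: (reflections_root g_simple h_cartan P_simple) => //. Qed.

Lemma at_angle_gamma x b : at_angle x b -> at_angle (x + 2 * pi / s%:R) (gamma b).
Proof.
move=> [rb [r r_gt0 zb]]; split; first exact: gamma_root.
by exists r; rewrite // z_gamma zb mulrCA -cisD -opprD addrC.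
Qed.

Lemma at_angle_gamma_inv x b : at_angle (x + 2 * pi / s%:R) b ->
  at_angle x (reflections P1 (reflections P2 b)).
Proof.
move=> [rb [r r_gt0 zb]]; split.
  by do 2!apply: (reflections_root g_simple h_cartan P_simple) => //.
exists r => //; apply: (mulfI (cis_neq0 (- (2 * pi / s%:R)))).
rewrite -z_gamma mulrCA -cisD -opprD (addrC _ x) -zb /gamma /=.
rewrite (reflectionsK g_simple h_cartan P_simple rP1 uP.1 P1_orth).
by rewrite (reflectionsK g_simple h_cartan P_simple rP2 uP.2 P2_orth).
Qed.

Lemma at_angle_opp x b : at_angle x b -> at_angle (x + pi) (- b).
Proof.
move=> [rb [r r_gt0 zb]]; split; first exact: (oppr_root g_simple h_cartan P_simple).
by exists r; rewrite // z_opp zb cisN_pi mulrN.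
Qed.

Lemma at_angle_opp_inv x b : at_angle (x + pi) b -> at_angle x (- b).
Proof.
move=> [rb [r r_gt0 zb]]; split; first exact: (oppr_root g_simple h_cartan P_simple).
by exists r; rewrite // z_opp zb cisN_pi mulrN opprK.
Qed.

(** If the rotation shifts indices by [k], then [s] rotations make a full turn, so
    [s * k = 2 * s]. *)
Lemma unwind_gamma n : T (n + 2)%N = T n + 2 * pi / s%:R.
Proof.
have s_gt0 : 0 < s%:R :> R by rewrite ltr0n; lia.
have [|k kE] := sector_shift at_angle_gamma at_angle_gamma_inv.
  by rewrite divr_gt0 // mulr_gt0 // pi_gt0.
have := shift_iter s 0%N kE; rewrite mulrCA mulfV ?gt_eqF // mulr1 -TD => /T_inj sk.
have k2 : k = 2%N by nia.
by rewrite -kE k2.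
Qed.

(** Two negations make a full turn, so the shift is half of [2 * s]. *)
Lemma unwind_opp n : T (n + s)%N = T n + pi.
Proof.
have [|k kE] := sector_shift at_angle_opp at_angle_opp_inv; first exact: pi_gt0.
have := shift_iter 2 0%N kE; rewrite -TD => /T_inj sk.
have ks : k = s by lia.
by rewrite -kE ks.
Qed.

Let T_le : {mono T : m n / (m <= n)%N >-> m <= n}.
Proof. exact/increasing_seqP. Qed.

Let T_lt : {mono T : m n / (m < n)%N >-> m < n}.
Proof. by move=> m n; rewrite !ltNge T_le ltnNge. Qed.

Lemma unwind_sector_inj m n b : (m < 2 * s)%N -> (n < 2 * s)%N ->
  sector m b -> sector n b -> m = n.
Proof.
move=> m_s n_s mb nb; apply/esym/T_inj/eqP; rewrite -subr_eq0; apply/eqP.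
apply: cos_eq1; last exact: at_angle_inj mb nb.
have bounds k : (k < 2 * s)%N -> T 0%N <= T k < T 0%N + 2 * pi.
  by move=> k_s; rewrite -TD T_le T_lt.
have := bounds m m_s; have := bounds n n_s; rewrite ltr_norml; lra.
Qed.

Lemma unwind_sector_period n b : sector (n + 2 * s)%N b <-> sector n b.
Proof. by rewrite /sector /= -/T TD; apply: at_angleD2pi. Qed.

Lemma unwind_sector_pos n b : (n < 2 * s)%N -> sector n b ->
  nonneg_comb (P1 ++ P2) b <-> (n < s)%N.
Proof.
move=> n_s nb; have rb : is_root b by case: nb.
split=> [b_pos|n_lt].
  have : positive_roots (P1 ++ P2) b by [].
  rewrite d_positive => -[i /= i_s]; rewrite direction_rootsE; last lia.
  by move=> ib; rewrite (unwind_sector_inj n_s _ nb ib); lia.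
have [] : positive_roots (P1 ++ P2) b => //.
rewrite d_positive; exists n.+1; first by rewrite /= n_lt.
by rewrite direction_rootsE //; lia.
Qed.

(* The rays of [T 0] and [T s.-1] bound a cone of opening less than [pi], so
   they are extreme: a sum of vectors of the cone lies on such a ray only if
   all its terms do. *)
Lemma unwind_sector_extreme m (n : dual h -> nat) : m = 0%N \/ m = s.-1 ->
  sector m (\sum_(b <- P1 ++ P2) b *+ n b) ->
  {in P1 ++ P2, forall b, n b != 0%N -> sector m b}.
Proof.
move=> m_ext m_sum.
(* Up to a positive factor, [f b] is the signed distance of the value of [b] from the line spanned
   by the ray of [T m]. *)
pose f b : R := complex.Im (z b * cis (T m)).
have fE k b : sector k b -> exists2 r, 0 < r & f b = r * sin (T m - T k).
  move=> [_ [r r_gt0 zb]]; exists r => //.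
  by rewrite /f zb -mulrA -cisD addrC /cis; simpc.
have fD b c : f (b + c) = f b + f c.
  rewrite /f /root_value add_lfunE mulrDl.
  by case: (_ * cis _) => ? ?; case: (_ * cis _).
have f0 : f 0 = 0 by apply: (addrI (f 0)); rewrite -fD !addr0.
have fMn b k : f (b *+ k) = f b *+ k.
  by elim: k => [|k IHk]; rewrite ?mulr0n // !mulrS fD IHk.
have sum0 : \sum_(b <- P1 ++ P2) f b *+ n b = 0.
  have [r _] := fE _ _ m_sum; rewrite subrr sin0 mulr0 (big_morph f fD f0) => sum0.
  by rewrite -[RHS]sum0; apply: eq_bigr => b _; rewrite fMn.
have [rP _ _] := P_simple.
have in_cone b : b \in P1 ++ P2 -> exists2 k, (k < s)%N & sector k b.
  move=> bP; have [k k_s kb] := root_at_angle (rP b bP); exists k => //.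
  by apply/(unwind_sector_pos k_s kb)/(nonneg_comb_simple P_simple).
have T_cone k : (k < s)%N -> T 0%N <= T k < T 0%N + pi.
  by move=> k_s; rewrite -unwind_opp T_le T_lt.
have [eps [eps_neq0 eps_ge0 eps_eq0]] : exists eps : R, [/\ eps != 0,
    {in P1 ++ P2, forall b, 0 <= eps * f b}
    & {in P1 ++ P2, forall b, f b = 0 -> sector m b}].
  have sin_eq0 x : 0 <= x < pi -> sin x = 0 -> x = 0.
    move=> /andP[x_ge0 x_lt] sinx; apply/eqP; rewrite eq_le x_ge0 andbT leNgt.
    apply/negP => x_gt0; have := sin_gt0_pi (x := x).
    by rewrite x_gt0 x_lt sinx ltxx => /(_ isT).
  (* The sign puts the whole cone on the nonnegative side of that line: -1 for the first ray, 1 for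
     the last. *)
  have sgn_m : exists eps : R, (eps = 1 \/ eps = - 1) /\
      forall k, (k < s)%N -> 0 <= eps * (T m - T k) < pi.
    have s1 : (s.-1 < s)%N by lia.
    case: m_ext => ->; [exists (- 1)|exists 1]; split; [by right| |by left|] => k k_s.
      by have := T_cone k k_s; rewrite mulN1r opprB; lra.
    have : T k <= T s.-1 by rewrite T_le; lia.
    by have := T_cone _ k_s; have := T_cone _ s1; rewrite mul1r; lra.
  have [eps [eps1 eps_m]] := sgn_m; exists eps.
  have sin_eps x : eps * sin x = sin (eps * x).
    by case: eps1 => ->; rewrite ?mul1r // !mulN1r sinN.
  have eps_neq0 : eps != 0 by case: eps1 => ->; rewrite ?oppr_eq0 oner_eq0.
  split=> // b /in_cone[k k_s kb]; have [r r_gt0 ->] := fE k b kb.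
    rewrite mulrCA sin_eps mulr_ge0 ?(ltW r_gt0) // sin_ge0_pi //.
    by have := eps_m k k_s; lra.
  move/eqP; rewrite mulf_eq0 gt_eqF //= => /eqP sin0.
  have := sin_eq0 _ (eps_m k k_s); rewrite -sin_eps sin0 mulr0 => /(_ erefl)/eqP.
  by rewrite mulf_eq0 (negPf eps_neq0) subr_eq0 => /eqP/T_inj ->.
move=> b bP nb; apply: eps_eq0 => //.
have /eqP : \sum_(b <- P1 ++ P2 | b \in P1 ++ P2) (eps * f b) *+ n b = 0.
  rewrite -big_seq; have := congr1 (fun x => eps * x) sum0.
  rewrite mulr0 mulr_sumr => eps_sum0; rewrite -[RHS]eps_sum0.
  by apply: eq_bigr => c _; rewrite mulrnAr.
rewrite psumr_eq0 => [/allP/(_ b bP)|c cP]; last by rewrite mulrn_wge0 ?eps_ge0.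
by rewrite bP mulrn_eq0 (negPf nb) mulf_eq0 (negPf eps_neq0) => /eqP.
Qed.

Lemma sector_gamma_orbits k :
  sector (2 * k) = iter k gamma @` [set` P2] /\
  sector ((2 * s).-1 + 2 * k) = iter k gamma @` [set - b | b in [set` P1]].
Proof.
apply: (sectorsE g_simple h_cartan P_simple P1_orth P2_orth s_gt2).
- by move=> n b [].
- by move=> b /root_at_angle[n n_s nb]; exists n.
- exact: unwind_sector_inj.
- exact: unwind_sector_period.
- exact: unwind_sector_pos.
- by move=> n b /at_angle_gamma; rewrite /sector /= -/T unwind_gamma.
- by move=> n b /at_angle_opp; rewrite /sector /= -/T unwind_opp.
- exact: unwind_sector_extreme.
Qed.

Let gamma_iter_isometry k b c :
  dual_form (iter k gamma b) (iter k gamma c) = dual_form b c.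
Proof.
elim: k => [//|k IHk]; rewrite !iterS /gamma /=.
by rewrite !(reflections_isometry g_simple h_cartan P_simple) // -IHk.
Qed.

Let orthogonal_iter k (Q : set (dual h)) : mutually_orthogonal Q ->
  mutually_orthogonal (iter k gamma @` Q).
Proof.
move=> Q_orth _ _ [b bQ <-] [c cQ <-] ne_bc; rewrite gamma_iter_isometry.
by apply: Q_orth => //; apply: contraNneq ne_bc => ->.
Qed.

(** The direction [d i] has index [i.-1], so odd [i] give the orbit of [P2] and even [i] that of the
    negatives of [P1]. Orthogonality is transported from [P1] and [P2], as [gamma] is an
    isometry. *)
Lemma direction_roots_gamma :
  [/\ forall i, (1 <= i <= 2 * s)%N ->
        mutually_orthogonal (direction_roots h E (d i)),
      forall k, (k <= s - 1)%N ->
        direction_roots h E (d (2 * k + 1)%N) = iter k gamma @` [set` P2],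
      forall k, (1 <= k <= s)%N ->
        direction_roots h E (d (2 * k)%N) =
          iter k gamma @` [set - b | b in [set` P1]]
    & direction_roots h E (d (2 * s)%N) = [set - b | b in [set` P1]]].
Proof.
have oddE k : (k <= s - 1)%N ->
    direction_roots h E (d (2 * k + 1)%N) = iter k gamma @` [set` P2].
  by move=> k_s; rewrite direction_rootsE ?addn1 /= ?(sector_gamma_orbits k).1 //; lia.
have evenE k : (1 <= k <= s)%N -> direction_roots h E (d (2 * k)%N) =
    iter k gamma @` [set - b | b in [set` P1]].
  move=> k_s; rewrite direction_rootsE; last lia.
  rewrite -(sector_gamma_orbits k).2; apply/seteqP.
  have -> : ((2 * s).-1 + 2 * k = (2 * k).-1 + 2 * s)%N by lia.
  by split=> b /unwind_sector_period.
split=> // [i i_s|]; last first.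
  rewrite direction_rootsE; last lia.
  by rewrite -[(2 * s).-1]addn0 (sector_gamma_orbits 0).2 image_id.
have [k [[k_s ->]|[k_s ->]]] : exists k,
    ((k <= s - 1)%N /\ i = (2 * k + 1)%N) \/ ((1 <= k <= s)%N /\ i = (2 * k)%N).
  exists i./2; have := odd_double_half i; case: (odd i); lia.
  by rewrite oddE //; apply: orthogonal_iter.
rewrite evenE //; apply: orthogonal_iter => _ _ [b bP <-] [c cP <-] ne_bc.
rewrite (dual_formNl g_simple h_cartan P_simple).
rewrite (dual_formNr g_simple h_cartan P_simple) opprK.
by apply: P1_orth => //; apply: contraNneq ne_bc => ->.
Qed.

End SingularSectors.

(** Evaluating [psi - alpha j] at [eps j] gives [q j - 1], which must be a natural number. *)
Lemma highest_root_coef_gt0 (K : numFieldType) (g : lieAlgebraType K)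
    (h : {vspace g}) (l : nat) (alpha : 'I_l -> dual h) (q : 'I_l -> nat)
    (eps : 'I_l -> subvs_of h) :
    (forall i j, alpha i (eps j) = (i == j)%:R) ->
    (forall i, is_root (alpha i)) ->
    highest_root (codom alpha) (\sum_(i < l) alpha i *+ q i) ->
  forall j, (0 < q j)%N.
Proof.
move=> alpha_eps alpha_root [_ psi_high] j.
have evE (n : 'I_l -> nat) : (\sum_(i < l) alpha i *+ n i) (eps j) = (n j)%:R :> K.
  rewrite sum_lfunE (bigD1 j) //= big1 => [|i /negPf ne_ij].
    by rewrite addr0 -(scaler_nat _ (alpha j)) scale_lfunE alpha_eps eqxx; apply: mulr1.
  by rewrite -(scaler_nat _ (alpha i)) scale_lfunE alpha_eps ne_ij; apply: mulr0.
have [n] := psi_high _ (alpha_root j); rewrite /codom /image_mem big_map big_enum /=.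
move=> /lfunP/(_ (eps j)); rewrite add_lfunE opp_lfunE !evE alpha_eps eqxx.
by case: (q j) => // /eqP; rewrite sub0r eq_sym -subr_eq0 opprK natr1 pnatr_eq0.
Qed.

(** * The cyclic element *)

Section CoxeterRotation.
Variables (R : realType) (g : lieAlgebraType R[i]) (g_simple : lie_simple g).
Variables (G : groupType) (expG : g -> G) (Ad : G -> 'End(g))
  (G_lie : lie_group_with expG Ad).
Variables (h : {vspace g}) (h_cartan : cartan_subalgebra h).
Variables (l : nat) (alpha : 'I_l -> dual h)
  (alpha_simple : simple_roots (codom alpha)).
Variables (psi : dual h) (psi_root : is_root psi).
Variables (q : 'I_l -> nat) (psi_q : psi = \sum_(i < l) alpha i *+ q i).
Variables (s : nat) (s_def : s = (1 + \sum_(i < l) q i)%N).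
Variables (e : dual h -> g) (eps : 'I_l -> subvs_of h).
Hypotheses (e_root : forall a, is_root a -> e a != 0 /\ root_vector a (e a))
  (alpha_eps : forall i j, alpha i (eps j) = (i == j)%:R).
Variables (c : 'I_l.+1 -> R[i]).

Let x0 : g := \sum_(i < l) vsval (eps i).
Let P0 : G := expG ((0 +i* (2 * pi / s%:R))%C *: x0).
Let E : g := \sum_(i < l.+1) c i *: e (affine_root alpha psi i).

Lemma Ad_exp_root_vector a (k : R) : is_root a ->
  a (\sum_(i < l) eps i) = k%:C%C :> R[i] ->
  Ad P0 (e a) = cis (2 * pi / s%:R * k) *: e a.
Proof.
move=> ra ak; have P0_exp := @Ad_exp _ _ _ _ _ G_lie ((0 +i* (2 * pi / s%:R))%C *: x0).
apply: (is_exp_imaginary_eigenvector P0_exp).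
rewrite adE lieZl /x0 -linear_sum; have [_ ->] := e_root ra.
by rewrite ak scalerA; congr (_ *: _); simpc.
Qed.

(** Each simple root takes the value 1 at [x0], and the lowest root [- psi] takes the value [1 - s];
    these agree modulo [s], so all terms of [E] are scaled alike. *)
Lemma Ad_exp_cyclic_element : Ad P0 E = cis (2 * pi / s%:R) *: E.
Proof.
have [alpha_root _ _] := alpha_simple.
have alpha_sum j : alpha j (\sum_(i < l) eps i) = 1 :> R[i].
  rewrite linear_sum (bigD1 j) //= alpha_eps eqxx big1 ?addr0 // => i ne_ij.
  by rewrite alpha_eps eq_sym (negPf ne_ij).
rewrite linear_sum scaler_sumr; apply: eq_bigr => i _.
rewrite linearZ /= scalerA mulrC -scalerA; congr (_ *: _).
rewrite /affine_root; case: unliftP => [j _|_].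
  rewrite (@Ad_exp_root_vector _ 1) ?mulr1 //; first exact/alpha_root/codom_f.
have s_neq0 : s%:R != 0 :> R by rewrite s_def pnatr_eq0.
rewrite (@Ad_exp_root_vector _ (1 - s%:R)); first last.
- rewrite opp_lfunE psi_q sum_lfunE.
  rewrite (eq_bigr (fun i => (q i)%:R)) => [|j _]; last first.
    by rewrite -(scaler_nat _ (alpha j)) scale_lfunE alpha_sum; apply: mulr1.
  rewrite -natr_sum s_def natrD opprD addrA subrr add0r rmorphN.
  by rewrite /= rmorph_nat.
- exact: (oppr_root g_simple h_cartan alpha_simple).
rewrite -[in LHS]cisD2pi; congr (cis _ *: _); field.
exact: s_neq0.
Qed.

Lemma Ad_inv_cyclic_element : Ad P0^-1%g E = cis (- (2 * pi / s%:R)) *: E.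
Proof.
have cisV : cis (- (2 * pi / s%:R)) * cis (2 * pi / s%:R) = 1 :> R[i].
  by rewrite -cisD addNr /cis cos0 sin0.
rewrite -{1}[E]scale1r -cisV -scalerA -Ad_exp_cyclic_element linearZ /=.
by rewrite -comp_lfunE -(AdM G_lie) mulVg (Ad1 G_lie) id_lfunE.
Qed.

(** [E] lies in [k] because it commutes with [k]; the dual action then evaluates [b] at the image of
    [- E] under the inverse of [Ad P0], a scalar multiple of [- E]. *)
Lemma root_value_dual_action (k : {vspace g}) (k_cartan : cartan_subalgebra k)
    (b : dual k) : {in k, forall x, lie E x = 0} ->
  root_value k E (dual_action (Ad P0^-1%g) b) =
    cis (- (2 * pi / s%:R)) * root_value k E b.
Proof.
move=> kE; have Ek : E \in k.
  apply/(root_vector0P k_cartan) => t; rewrite zero_lfunE scale0r lieC.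
  by rewrite kE ?oppr0 ?subvsP.
rewrite /root_value /dual_action !comp_lfunE !lfunE /= vsprojK ?memvN //.
by rewrite linearN /= Ad_inv_cyclic_element -scalerN !linearZ.
Qed.

End CoxeterRotation.

Theorem corollary5p10 (R : realType)
  (g : lieAlgebraType R[i]) (g_simple : lie_simple g)
  (G : groupType) (expG : g -> G) (Ad : G -> 'End(g))
  (G_lie : lie_group_with expG Ad)
  (h : {vspace g}) (h_cartan : cartan_subalgebra h)
  (l : nat) (l_gt1 : (1 < l)%N)
  (alpha : 'I_l -> dual h) (alpha_simple : simple_roots (codom alpha))
  (psi : dual h) (psi_highest : highest_root (codom alpha) psi)
  (q : 'I_l -> nat) (psi_q : psi = \sum_(i < l) alpha i *+ q i)
  (s : nat) (s_def : s = (1 + \sum_(i < l) q i)%N)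
  (e : dual h -> g)
  (e_root : forall a, is_root a -> e a != 0 /\ root_vector a (e a))
  (eps : 'I_l -> subvs_of h)
  (alpha_eps : forall i j, alpha i (eps j) = (i == j)%:R)
  (x0 : g) (x0_def : x0 = \sum_(i < l) vsval (eps i))
  (P0 : G) (P0_def : P0 = expG ((0 +i* (2 * pi / s%:R))%C *: x0))
  (c : 'I_l.+1 -> R[i]) (c_neq0 : forall i, c i != 0)
  (E : g) (E_def : E = \sum_(i < l.+1) c i *: e (affine_root alpha psi i))
  (h' : {vspace g}) (h'_cartan : cartan_subalgebra h')
  (h'_centralizes : {in h', forall x, lie E x = 0})
  (P1 P2 : seq (dual h')) (P_simple : simple_roots (P1 ++ P2))
  (P1_orth : mutually_orthogonal [set` P1])
  (P2_orth : mutually_orthogonal [set` P2])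
  (gamma : dual h' -> dual h')
  (gamma_def : gamma = reflections P2 \o reflections P1)
  (gamma_Ad : forall phi : dual h', gamma phi = dual_action (Ad P0^-1%g) phi)
  (d : nat -> set R[i])
  (d_labelling : clockwise_labelling h' E (2 * s) d)
  (d_positive : positive_roots (P1 ++ P2) =
     \bigcup_(i in [set i | (1 <= i <= s)%N]) direction_roots h' E (d i)) :
  [/\ forall i, (1 <= i <= 2 * s)%N ->
        mutually_orthogonal (direction_roots h' E (d i)),
      forall k, (k <= s - 1)%N ->
        direction_roots h' E (d (2 * k + 1)%N) = iter k gamma @` [set` P2],
      forall k, (1 <= k <= s)%N ->
        direction_roots h' E (d (2 * k)%N) =
          iter k gamma @` [set - b | b in [set` P1]]
    & direction_roots h' E (d (2 * s)%N) = [set - b | b in [set` P1]]].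
Proof.
have [alpha_root _ _] := alpha_simple.
have alpha_is_root i : is_root (alpha i) by apply/alpha_root/codom_f.
have [psi_root _] := psi_highest.
(* All [l] coefficients of the highest root are at least 1, so [s] is at least [1 + l]. *)
have s_gt2 : (2 < s)%N.
  rewrite psi_q in psi_highest.
  have q_gt0 := highest_root_coef_gt0 alpha_eps alpha_is_root psi_highest.
  rewrite s_def ltnS; apply: leq_trans l_gt1 _.
  by rewrite -[X in (X <= _)%N]card_ord -sum1_card; apply: leq_sum => i _.
have z_gamma (b : dual h') :
    root_value h' E ((reflections P2 \o reflections P1) b) =
      cis (- (2 * pi / s%:R)) * root_value h' E b.
  rewrite -gamma_def gamma_Ad E_def P0_def x0_def.
  apply: (root_value_dual_action g_simple G_lie h_cartan alpha_simple psi_root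
    psi_q s_def e_root alpha_eps h'_cartan).
  by rewrite -E_def.
have [d_all [theta [d_ray theta_incr theta_turn]]] := d_labelling.
rewrite gamma_def.
exact: (direction_roots_gamma g_simple h'_cartan P_simple P1_orth P2_orth s_gt2
  z_gamma d_all d_ray theta_incr theta_turn d_positive).
Qed.
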